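(* Let $f:\mathbb{R}^n\to\mathbb{R}$ be convex and $L$-smooth, with stochastic gradients satisfying $\mathbb{E}_\xi[\nabla f(x,\xi)]=\nabla f(x)$ and $\mathbb{E}_\xi[\|\nabla f(x,\xi)-\nabla f(x)\|_2^2]\le\sigma^2$ for all $x\in\mathbb{R}^n$. Let $x^*$ be a minimizer of $f$, $R_0=\|x^0-x^*\|_2>0$ and $C=\sqrt2$. Then for all $\beta\in(0,1)$ and $N\ge1$ such that $\ln\frac{4N}{\beta}\ge2$, after $N$ iterations of clipped-SGD started at $x^0$ with $$\lambda=2LCR_0,\qquad m_k=m=\left\lceil\max\left\{1,\frac{27N\sigma^2}{2(CR_0)^2L^2\ln\frac{4N}{\beta}}\right\}\right\rceil,\qquad\gamma=\frac{1}{80L\ln\frac{4N}{\beta}},$$ we have, with probability at least $1-\beta$, $$f(\bar x^N)-f(x^* )\le\frac{80LC^2R_0^2\ln\frac{4N}{\beta}}{N},\qquad\bar x^N=\frac1N\sum_{k=0}^{N-1}x^k.$$ In other words, there is an absolute constant $K$ such that with $N=\left\lceil K\frac{LR_0^2}{\varepsilon}\ln\frac{LR_0^2}{\varepsilon\beta}\right\rceil$ iterations the method achieves $f(\bar x^N)-f(x^* )\le\varepsilon$ with probability at least $1-\beta$, and it requires $$O\left(\max\left\{\frac{LR_0^2}{\varepsilon},\frac{\sigma^2R_0^2}{\varepsilon^2}\right\}\ln\frac{LR_0^2}{\varepsilon\beta}\right)$$ oracle calls.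
   Context: Problem: minimize $f(x)=\mathbb{E}_\xi[f(x,\xi)]$ over $x\in\mathbb{R}^n$; a minimizer $x^*$ is assumed to exist. $f$ is accessed only through stochastic gradients $\nabla f(x,\xi)$; $\sigma\ge0$; nothing is assumed about their distribution beyond unbiasedness and variance at most $\sigma^2$. One oracle call is one sample of $\nabla f(x,\xi)$. $f$ is $L$-smooth ($L>0$) if it is differentiable and $\|\nabla f(x)-\nabla f(y)\|_2\le L\|x-y\|_2$ for all $x,y$. Clipping: $\mathrm{clip}(g,\lambda)=\min\{1,\lambda/\|g\|_2\}\,g$ (and $\mathrm{clip}(0,\lambda)=0$). Algorithm clipped-SGD. Inputs: deterministic starting point $x^0$, number of iterations $N$, batchsizes $m_0,\dots,m_{N-1}$ (positive integers), stepsize $\gamma>0$, clipping level $\lambda>0$. For $k=0,\dots,N-1$: draw fresh i.i.d. samples $\xi_1^k,\dots,\xi_{m_k}^k$ (independent of the past) and compute $\nabla f(x^k,\boldsymbol{\xi}^k)=\frac1{m_k}\sum_{i=1}^{m_k}\nabla f(x^k,\xi_i^k)$; compute $\widetilde\nabla f(x^k,\boldsymbol{\xi}^k)=\mathrm{clip}(\nabla f(x^k,\boldsymbol{\xi}^k),\lambda)$; set $x^{k+1}=x^k-\gamma\widetilde\nabla f(x^k,\boldsymbol{\xi}^k)$. Output: $\bar x^N=\frac1N\sum_{k=0}^{N-1}x^k$. $O(\cdot)$ hides absolute numerical constants; complexity bounds are for target accuracies $0<\varepsilon\le LR_0^2/2$. *)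

(* Defs.v *)
From HB Require Import structures.
From mathcomp Require Import all_boot all_order all_algebra finmap.
From mathcomp Require Import all_classical all_reals all_analysis.

Set Implicit Arguments.
Unset Strict Implicit.
Unset Printing Implicit Defensive.

Import Order.TTheory GRing.Theory Num.Theory.
Import numFieldNormedType.Exports.

Local Open Scope classical_set_scope.
Local Open Scope ring_scope.

(* The library norm on 'rV[R]_n is the sup norm, hence this definition. *)
Definition norm2 (R : realType) (n : nat) (x : 'rV[R]_n) : R :=
  Num.sqrt (\sum_(i < n) x 0 i ^+ 2).

(* This is the gradient wherever f is differentiable. *)
Definition grad (R : realType) (n : nat) (f : 'rV[R]_n -> R) (x : 'rV[R]_n) :
  'rV[R]_n := \row_(i < n) 'D_(delta_mx 0 i) f x.

Definition smooth (R : realType) (n : nat) (L : R) (f : 'rV[R]_n -> R) : Prop :=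
  (forall x, differentiable f x) /\
  (forall x y, norm2 (grad f x - grad f y) <= L * norm2 (x - y)).

Definition minimizer (R : realType) (n : nat) (f : 'rV[R]_n -> R)
  (xs : 'rV[R]_n) : Prop := forall x, f xs <= f x.

(* The natural number ceiling of a nonnegative real. *)
Definition ceil_nat (R : realType) (x : R) : nat := `|Num.ceil x|%N.

Definition borel_rV (R : realType) (n : nat) :=
  g_sigma_algebraType (@open 'rV[R]_n).

(* G x z is the stochastic gradient at x computed from the sample z, whose law
   is D.  Joint measurability makes every iterate of a method that queries G a
   random vector.  The variance bound gives integrability, so the coordinatewise
   expectations are genuine ones. *)
Definition stochastic_gradient (R : realType) (n : nat) (d : measure_display)
    (Z : measurableType d) (D : probability Z R) (f : 'rV[R]_n -> R) (sigma : R)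
    (G : 'rV[R]_n -> Z -> 'rV[R]_n) : Prop :=
  [/\ forall i : 'I_n,
        measurable_fun setT (fun p : borel_rV R n * Z => G p.1 p.2 0 i),
      forall (x : 'rV[R]_n) (i : 'I_n),
        'E_D[(fun z => G x z 0 i)%R]%E = (grad f x 0 i)%:E
    & forall x : 'rV[R]_n,
        ('E_D[(fun z => norm2 (G x z - grad f x) ^+ 2)%R] <= (sigma ^+ 2)%R%:E)%E].

Definition mutually_independent (R : realType) (d d' : measure_display)
    (Omega : measurableType d) (Z : measurableType d') (P : probability Omega R)
    (I : choiceType) (S : set I) (X : I -> {RV P >-> Z}) : Prop :=
  forall J : {fset I}, [set` J] `<=` S ->
  forall B : I -> set Z, (forall i, measurable (B i)) ->
    P (\bigcap_(i in [set` J]) X i @^-1` B i) =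
    (\prod_(i <- J) P (X i @^-1` B i))%E.

(* xi k i is the i-th sample of iteration k; only the samples with k < N and
   i < m k are constrained. *)
Definition iid_samples (R : realType) (d d' : measure_display)
    (Omega : measurableType d) (Z : measurableType d') (P : probability Omega R)
    (D : probability Z R) (N : nat) (m : nat -> nat)
    (xi : nat -> nat -> {RV P >-> Z}) : Prop :=
  (forall k i, (k < N)%N -> (i < m k)%N ->
     forall A, measurable A -> distribution P (xi k i) A = D A) /\
  mutually_independent [set ki : nat * nat | (ki.1 < N)%N && (ki.2 < m ki.1)%N]
    (fun ki => xi ki.1 ki.2).

(* The convention clip 0 lambda = 0 holds because of the scaling of 0. *)
Definition clip (R : realType) (n : nat) (g : 'rV[R]_n) (lambda : R) :
  'rV[R]_n := Num.min 1 (lambda / norm2 g) *: g.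

Definition minibatch (R : realType) (n : nat) (Z : Type)
    (G : 'rV[R]_n -> Z -> 'rV[R]_n) (m : nat) (x : 'rV[R]_n) (z : nat -> Z) :
  'rV[R]_n := m%:R^-1 *: \sum_(i < m) G x (z i).

(* The iterates on one realization z of the samples. *)
Fixpoint clipped_sgd (R : realType) (n : nat) (Z : Type)
    (G : 'rV[R]_n -> Z -> 'rV[R]_n) (x0 : 'rV[R]_n) (m : nat -> nat)
    (gamma lambda : R) (z : nat -> nat -> Z) (k : nat) : 'rV[R]_n :=
  if k is k'.+1 then
    let x := clipped_sgd G x0 m gamma lambda z k' in
    x - gamma *: clip (minibatch G (m k') x (z k')) lambda
  else x0.

Definition clipped_sgd_output (R : realType) (n : nat) (Z : Type)
    (G : 'rV[R]_n -> Z -> 'rV[R]_n) (x0 : 'rV[R]_n) (N : nat) (m : nat -> nat)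
    (gamma lambda : R) (z : nat -> nat -> Z) : 'rV[R]_n :=
  N%:R^-1 *: \sum_(k < N) clipped_sgd G x0 m gamma lambda z k.

Definition oracle_calls (N : nat) (m : nat -> nat) : nat := \sum_(k < N) m k.

Definition clip_level (R : realType) (L C R0 : R) : R := 2 * L * C * R0.

Definition batchsize (R : realType) (L sigma C R0 beta : R) (N : nat) : nat :=
  ceil_nat (Num.max 1 (27 * N%:R * sigma ^+ 2 /
                       (2 * (C * R0) ^+ 2 * L ^+ 2 * ln (4 * N%:R / beta)))).

Definition stepsize (R : realType) (L beta : R) (N : nat) : R :=
  (80 * L * ln (4 * N%:R / beta))^-1.

(* Main.v *)
(** Let [V k = |x_k - xs|^2 + gamma * \sum_(j < k) (f x_j - f xs)].  Convexity and
    smoothness bound [V k.+1 - V k] by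
    [Delta = -2 gamma <theta, x_k - xs> + 2 gamma^2 |theta|^2], where [theta] is the
    error of the clipped minibatch gradient.  While [V k <= 2 R0^2] the true gradient has
    norm at most [lambda / 2]; since clipping is the projection onto a ball, it then
    does not increase the error [e] of the minibatch gradient, and it moves that
    gradient by at most [|e|^2 / (2 lambda)].  With [l = ln (4 N / beta)] and
    [s = 2 l / R0^2] one has [s Delta <= 1/2], so [exp (s Delta)] is at most
    [1 - 2 s gamma <e, x_k - xs>] plus a multiple of [|e|^2], a sum whose conditional
    expectation is at most [exp (l / N)] by the choice of the batchsize.  Hence
    [E (exp (s V N)) <= exp (3 l)] for the process stopped on leaving
    [V k <= 2 R0^2], and Markov's inequality bounds the probability of ever leaving
    it by [exp (- l) = beta / (4 N)].  Otherwise [V N <= 2 R0^2], which by convexity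
    is the claim.  Conditional expectations are avoided: the past and the fresh
    samples generate independent sigma-algebras on the probability space, and
    Fubini's theorem applies to the product of the two. *)

Require Import Defs.
From HB Require Import structures.
From mathcomp Require Import all_boot all_order all_algebra finmap.
From mathcomp Require Import all_classical all_reals all_analysis.
From mathcomp Require Import measurable_realfun ring lra.

Import Order.TTheory GRing.Theory Num.Theory.
Import numFieldNormedType.Exports.

Local Open Scope classical_set_scope.
Local Open Scope ring_scope.

Set Implicit Arguments.
Unset Strict Implicit.
Unset Printing Implicit Defensive.

(** * Euclidean geometry and clipping *)

Definition dot (R : realType) (n : nat) (u v : 'rV[R]_n) : R :=
  \sum_(i < n) u 0 i * v 0 i.

Lemma dotC (R : realType) (n : nat) (u v : 'rV[R]_n) : dot u v = dot v u.
Proof. by apply: eq_bigr => i _; rewrite mulrC. Qed.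

Lemma dotDl (R : realType) (n : nat) (u v w : 'rV[R]_n) :
  dot (u + v) w = dot u w + dot v w.
Proof. by rewrite -big_split; apply: eq_bigr => i _; rewrite mxE mulrDl. Qed.

Lemma dotZl (R : realType) (n : nat) (a : R) (u v : 'rV[R]_n) :
  dot (a *: u) v = a * dot u v.
Proof. by rewrite mulr_sumr; apply: eq_bigr => i _; rewrite mxE mulrA. Qed.

Lemma dotNl (R : realType) (n : nat) (u v : 'rV[R]_n) :
  dot (- u) v = - dot u v.
Proof. by rewrite -scaleN1r dotZl mulN1r. Qed.

Lemma dotDr (R : realType) (n : nat) (u v w : 'rV[R]_n) :
  dot u (v + w) = dot u v + dot u w.
Proof. by rewrite dotC dotDl ![dot _ u]dotC. Qed.

Lemma dotZr (R : realType) (n : nat) (a : R) (u v : 'rV[R]_n) :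
  dot u (a *: v) = a * dot u v.
Proof. by rewrite dotC dotZl dotC. Qed.

Lemma dotNr (R : realType) (n : nat) (u v : 'rV[R]_n) :
  dot u (- v) = - dot u v.
Proof. by rewrite dotC dotNl dotC. Qed.

Definition dotE := (dotDl, dotDr, dotNl, dotNr, dotZl, dotZr).

Lemma norm2_ge0 (R : realType) (n : nat) (u : 'rV[R]_n) : 0 <= norm2 u.
Proof. exact: sqrtr_ge0. Qed.

Lemma sqr_norm2 (R : realType) (n : nat) (u : 'rV[R]_n) : norm2 u ^+ 2 = dot u u.
Proof.
rewrite sqr_sqrtr; last by apply: sumr_ge0 => i _; exact: sqr_ge0.
by apply: eq_bigr => i _; rewrite expr2.
Qed.

(** Cauchy-Schwarz: for nonzero [u], expand the squared norm of [dot u v *: u - norm2 u ^+ 2 *: v].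
    It is [norm2 u ^+ 2] times the gap between [(norm2 u * norm2 v) ^+ 2] and [dot u v ^+ 2]. *)
Lemma dot_le_norm2 (R : realType) (n : nat) (u v : 'rV[R]_n) :
  dot u v <= norm2 u * norm2 v.
Proof.
have [u0|u0] := eqVneq (norm2 u) 0.
  have z i : u 0 i = 0.
    have /eqP := sqr_norm2 u; rewrite u0 expr0n /= eq_sym.
    rewrite psumr_eq0 => [/allP|j _]; last by rewrite -expr2 sqr_ge0.
    by move=> /(_ i); rewrite mem_index_enum mulf_eq0 orbb => /(_ isT) /eqP.
  by rewrite u0 mul0r /dot big1 // => i _; rewrite z mul0r.
have up : 0 < norm2 u by rewrite lt_neqAle eq_sym u0 norm2_ge0.
have /= := sqr_ge0 (norm2 (dot u v *: u - norm2 u ^+ 2 *: v)).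
rewrite [X in 0 <= X]sqr_norm2 !dotE -!sqr_norm2 [dot v u]dotC => h.
have {}h : 0 <= norm2 u ^+ 2 * ((norm2 u * norm2 v) ^+ 2 - dot u v ^+ 2).
  by apply: le_trans h _; rewrite le_eqVlt; apply/orP; left; apply/eqP; ring.
rewrite pmulr_rge0 ?exprn_gt0 // subr_ge0 in h.
apply: le_trans (ler_norm _) _.
by rewrite -(ler_pXn2r (n := 2)) ?nnegrE ?mulr_ge0 ?norm2_ge0 // real_normK ?num_real.
Qed.

Lemma norm2N (R : realType) (n : nat) (u : 'rV[R]_n) : norm2 (- u) = norm2 u.
Proof. by congr Num.sqrt; apply: eq_bigr => i _; rewrite mxE sqrrN. Qed.

Lemma normr_dot_le (R : realType) (n : nat) (u v : 'rV[R]_n) :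
  `|dot u v| <= norm2 u * norm2 v.
Proof.
by rewrite ler_norml dot_le_norm2 andbT lerNl -dotNl -(norm2N u) dot_le_norm2.
Qed.

Lemma norm2Z (R : realType) (n : nat) (a : R) (u : 'rV[R]_n) :
  norm2 (a *: u) = `|a| * norm2 u.
Proof.
apply/eqP; rewrite -(eqrXn2 (n := 2)) ?mulr_ge0 ?norm2_ge0 //.
by rewrite exprMn real_normK ?num_real // !sqr_norm2 !dotE; apply/eqP; ring.
Qed.

Lemma norm2_0 (R : realType) (n : nat) : norm2 (0 : 'rV[R]_n) = 0.
Proof. by rewrite -(scale0r (0 : 'rV[R]_n)) norm2Z normr0 mul0r. Qed.

Lemma norm2D_le (R : realType) (n : nat) (u v : 'rV[R]_n) :
  norm2 (u + v) <= norm2 u + norm2 v.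
Proof.
rewrite -(ler_pXn2r (n := 2)) ?nnegrE ?addr_ge0 ?norm2_ge0 //.
rewrite sqr_norm2 !dotE [dot v u]dotC sqrrD -!sqr_norm2.
by have := dot_le_norm2 u v; lra.
Qed.

Lemma sqr_norm2D_le (R : realType) (n : nat) (u v : 'rV[R]_n) :
  norm2 (u + v) ^+ 2 <= 2 * norm2 u ^+ 2 + 2 * norm2 v ^+ 2.
Proof.
by have := sqr_ge0 (norm2 (u - v)); rewrite !sqr_norm2 !dotE [dot v u]dotC; lra.
Qed.

(** Case analysis that hides the minimum and the quotient by [norm2 g]; [g = 0] falls under the
    first case. *)
Variant clip_spec (R : realType) (n : nat) (g : 'rV[R]_n) (lambda : R) :
    'rV[R]_n -> Prop :=
  | ClipInside of norm2 g <= lambda : clip_spec g lambda g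
  | ClipOutside of lambda < norm2 g :
      clip_spec g lambda ((lambda / norm2 g) *: g).

Lemma clipP (R : realType) (n : nat) (g : 'rV[R]_n) (lambda : R) :
  0 < lambda -> clip_spec g lambda (clip g lambda).
Proof.
move=> l0; rewrite /clip; have [gl|lg] := leP (norm2 g) lambda.
- have [g0|g0] := eqVneq (norm2 g) 0.
    have -> : g = 0.
      apply/rowP => i; have /eqP := sqr_norm2 g; rewrite g0 expr0n /= eq_sym.
      rewrite psumr_eq0 => [/allP|j _]; last by rewrite -expr2 sqr_ge0.
      move=> /(_ i); rewrite mem_index_enum mulf_eq0 orbb => /(_ isT) /eqP ->.
      by rewrite mxE.
    rewrite scaler0; constructor.
    by rewrite norm2_0 ltW.
  have gp : 0 < norm2 g by rewrite lt_neqAle eq_sym g0 norm2_ge0.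
  rewrite minElt (_ : (1 < _) = (norm2 g < lambda)) ?ltr_pdivlMr ?mul1r //.
  case: ltP => lg; first by rewrite scale1r; constructor.
  (* At equality the scaling factor is 1, so [g] is again left in place. *)
  have -> : lambda = norm2 g by apply/eqP; rewrite eq_le lg gl.
  by rewrite divff // scale1r; constructor.
- have gp : 0 < norm2 g by exact: lt_trans lg.
  rewrite min_r; first by constructor.
  by rewrite ler_pdivrMr // mul1r ltW.
Qed.

Lemma norm2_clip_le (R : realType) (n : nat) (g : 'rV[R]_n) (lambda : R) :
  0 < lambda -> norm2 (clip g lambda) <= lambda.
Proof.
move=> l0; case: (clipP g l0) => // lg.
have gp : 0 < norm2 g by exact: lt_trans lg.
by rewrite norm2Z gtr0_norm ?divr_gt0 // divfK // gt_eqF.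
Qed.

(** Clipping projects onto the ball of radius [lambda], so it brings [g] no farther from a point of
    that ball. With [c = lambda / norm2 g < 1], the squared distances differ by [(1 - c) * ((norm2 g
    + lambda) * norm2 g - 2 * dot g mu)], where [dot g mu <= norm2 g * lambda]. *)
Lemma norm2_clipB_le (R : realType) (n : nat) (g mu : 'rV[R]_n) (lambda : R) :
  0 < lambda -> norm2 mu <= lambda ->
  norm2 (clip g lambda - mu) <= norm2 (g - mu).
Proof.
move=> l0 mul; case: (clipP g l0) => // lg.
have gp : 0 < norm2 g by exact: lt_trans lg.
rewrite -(ler_pXn2r (n := 2)) ?nnegrE ?norm2_ge0 // !sqr_norm2 !dotE.
rewrite ![dot mu g]dotC -!sqr_norm2.
set c := lambda / norm2 g; have cg : c * norm2 g = lambda by rewrite divfK ?gt_eqF.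
have c0 : 0 < c by rewrite divr_gt0.
have c1 : c < 1 by rewrite ltr_pdivrMr // mul1r.
have gm : dot g mu <= norm2 g * lambda.
  by apply: le_trans (dot_le_norm2 _ _) _; rewrite ler_pM2l.
rewrite -subr_ge0.
rewrite [X in 0 <= X](_ : _ =
   (1 - c) * ((norm2 g + c * norm2 g) * norm2 g - 2 * dot g mu)); last by ring.
rewrite cg mulr_ge0 ?subr_ge0 ?(ltW c1) //; nra.
Qed.

(** Outside the ball the displacement is [norm2 g - lambda]. With [t = norm2 (g - mu)] the triangle
    inequality makes it at most [t - lambda / 2], hence at most [t ^+ 2 / (2 * lambda)] because
    [(t - lambda) ^+ 2 >= 0]. *)
Lemma norm2_subr_clip_le (R : realType) (n : nat) (g mu : 'rV[R]_n) (lambda : R) :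
  0 < lambda -> norm2 mu <= lambda / 2 ->
  norm2 (g - clip g lambda) <= norm2 (g - mu) ^+ 2 / (2 * lambda).
Proof.
move=> l0 mul; case: (clipP g l0) => lg.
  rewrite subrr norm2_0.
  by rewrite divr_ge0 ?exprn_ge0 ?norm2_ge0 ?mulr_ge0 ?(ltW l0).
have gp : 0 < norm2 g by exact: lt_trans lg.
have -> : g - lambda / norm2 g *: g = (1 - lambda / norm2 g) *: g.
  by rewrite scalerBl scale1r.
have c1 : lambda / norm2 g <= 1 by rewrite ler_pdivrMr // mul1r ltW.
rewrite norm2Z ger0_norm ?subr_ge0 // mulrBl mul1r divfK ?gt_eqF //.
rewrite ler_pdivlMr ?mulr_gt0 //.
have := norm2D_le (g - mu) mu; rewrite subrK => tri.
have := sqr_ge0 (norm2 (g - mu) - lambda); nra.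
Qed.

(** From [expR (- y) >= 1 - y] one gets [expR y <= (1 - y)^-1], and [(1 + y + 2 * y ^+ 2) * (1 - y)
    = 1 + y ^+ 2 * (1 - 2 * y)] is at least 1 in this range. *)
Lemma expR_le_quadratic (R : realType) (y : R) :
  y <= 2^-1 -> expR y <= 1 + y + 2 * y ^+ 2.
Proof.
move=> y2; have := expR_ge1Dx (- y); rewrite expRN => h.
have ey : 0 < expR y := expR_gt0 y.
have y1 : 0 < 1 - y by lra.
have {}h : expR y * (1 - y) <= 1.
  by rewrite -[leRHS](mulfV (lt0r_neq0 ey)) ler_pM2l.
have : 1 <= (1 + y + 2 * y ^+ 2) * (1 - y).
  have -> : (1 + y + 2 * y ^+ 2) * (1 - y) = 1 + y ^+ 2 * (1 - 2 * y) by ring.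
  by rewrite lerDl mulr_ge0 ?sqr_ge0 //; lra.
by move=> h2; rewrite -(ler_pM2r y1); exact: le_trans h2.
Qed.

(* One step of clipped-SGD from a point [x] with [v = x - xs], where [mu] is the
   gradient, [delta = f x - f xs] and [g] the minibatch gradient. *)
Lemma expR_clipped_step_le (R : realType) (n : nat) (L l rho C delta : R)
    (v mu g : 'rV[R]_n)
    (gamma := (80 * L * l)^-1) (lambda := clip_level L C rho)
    (s := 2 * l / rho ^+ 2) :
  0 < L -> 2 <= l -> 0 < rho -> 0 < C -> C ^+ 2 = 2 ->
  norm2 v <= C * rho -> norm2 mu <= L * norm2 v ->
  delta <= dot mu v -> norm2 mu ^+ 2 <= 2 * L * delta ->
  expR (s * (norm2 (v - gamma *: clip g lambda) ^+ 2 - norm2 v ^+ 2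
             + gamma * delta)) <=
  1 - 2 * s * gamma * dot (g - mu) v +
  (20 * L ^+ 2 * rho ^+ 2)^-1 * norm2 (g - mu) ^+ 2.
Proof.
move=> L0 l2 rho0 C0 C2 vr muv dv mud.
have l0 : 0 < l by lra.
have gam0 : 0 < gamma by rewrite invr_gt0 !mulr_gt0.
have lam0 : 0 < lambda by rewrite /lambda /clip_level !mulr_gt0.
have s0 : 0 < s by rewrite !mulr_gt0 // invr_gt0 exprn_gt0.
have gL : 80 * gamma * L * l = 1.
  by rewrite /gamma; field; rewrite !gt_eqF.
have gL1 : 160 * (gamma * L) <= 1.
  rewrite -gL; have := mulr_gt0 gam0 L0; nra.
have sr : s * rho ^+ 2 = 2 * l by rewrite /s divfK // expf_neq0 // gt_eqF.
(* [th] is the error after clipping, [h] its norm, and [t] the norm of the error before clipping. *)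
set th := clip g lambda - mu; set h := norm2 th; set t := norm2 (g - mu).
set a := norm2 v.
have a0 : 0 <= a by exact: norm2_ge0.
have h0 : 0 <= h by exact: norm2_ge0.
have mul2 : norm2 mu <= lambda / 2.
  apply: le_trans muv _; rewrite /lambda /clip_level.
  by rewrite (_ : _ / 2 = L * (C * rho)) ?ler_pM2l //; field.
have mul : norm2 mu <= lambda by apply: le_trans mul2 _; lra.
have ht : h <= t by exact: norm2_clipB_le.
have hl : h <= 3 * L * C * rho.
  have := norm2D_le (clip g lambda) (- mu); rewrite norm2N -/th -/h => h1.
  have := norm2_clip_le g lam0; move: h1 mul2; rewrite /lambda /clip_level; lra.
set Delta := - 2 * gamma * dot th v + 2 * gamma ^+ 2 * h ^+ 2.
(* Convexity turns [- 2 * gamma * dot mu v] into [- 2 * gamma * delta]. One half cancels the added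
   [gamma * delta]; the other absorbs the [4 * L * gamma ^+ 2 * delta] left by the square, as
   [gamma * L <= 1 / 160]. *)
have incD : norm2 (v - gamma *: clip g lambda) ^+ 2 - a ^+ 2 + gamma * delta
    <= Delta.
  have -> : clip g lambda = mu + th by rewrite /th addrC subrK.
  have N := sqr_norm2D_le mu th; rewrite -/h in N.
  rewrite sqr_norm2 dotDl !dotDr !dotNl !dotNr !dotZl !dotZr -!sqr_norm2.
  rewrite [dot v (mu + th)]dotC dotDl -/a /Delta.
  have E1 : gamma ^+ 2 * norm2 (mu + th) ^+ 2 <=
      gamma ^+ 2 * (2 * (2 * L * delta) + 2 * h ^+ 2).
    by rewrite ler_pM2l ?exprn_gt0 //; lra.
  have E2 : gamma * delta <= gamma * dot mu v by rewrite ler_pM2l.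
  have d0 : 0 <= delta.
    rewrite -(pmulr_rge0 _ (mulr_gt0 (ltr0n R 2) L0)).
    by apply: le_trans mud; exact: sqr_ge0.
  have E3 : (160 * (gamma * L)) * (gamma * delta) <= gamma * delta.
    by apply: ler_piMl => //; rewrite mulr_ge0 // ltW.
  have E4 : 0 <= gamma * delta by rewrite mulr_ge0 // ltW.
  have -> : gamma * (gamma * norm2 (mu + th) ^+ 2) =
    gamma ^+ 2 * norm2 (mu + th) ^+ 2 by ring.
  by lra.
have CSth : `|dot th v| <= h * (C * rho).
  apply: le_trans (normr_dot_le th v) _.
  by rewrite ler_wpM2l.
(* Since [h <= 3 * L * C * rho] and [gamma * L <= 1 / 160], the quadratic part of [Delta] is at most
   [gamma * (C * rho) * h]. *)
have Dh : `|Delta| <= 3 * gamma * (C * rho) * h.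
  have -> : 3 * gamma * (C * rho) * h =
    2 * gamma * (h * (C * rho)) + gamma * (C * rho) * h by ring.
  apply: le_trans (ler_normD _ _) _; apply: lerD.
    rewrite normrM mulNr normrN (@gtr0_norm _ (2 * gamma)) ?mulr_gt0 //.
    by rewrite ler_pM2l ?mulr_gt0.
  rewrite ger0_norm; last by rewrite mulr_ge0 ?exprn_ge0 // mulr_ge0 ?exprn_ge0 // ltW.
  have -> : 2 * gamma ^+ 2 * h ^+ 2 = gamma * h * (2 * gamma * h) by ring.
  have -> : gamma * (C * rho) * h = gamma * h * (C * rho) by ring.
  apply: ler_wpM2l; first by rewrite mulr_ge0 // ltW.
  apply: (@le_trans _ _ (2 * gamma * (3 * L * C * rho))).
    rewrite -!mulrA ler_pM2l // ler_pM2l //; move: hl; rewrite !mulrA; lra.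
  have := mulr_gt0 C0 rho0; nra.
(* Inserting the bound on [h] gives [18 * gamma * L * (s * rho ^+ 2) = 36 * gamma * L * l = 36 /
   80]. *)
have sD2 : s * Delta <= 2^-1.
  apply: (@le_trans _ _ (s * (9 * gamma * L * (C ^+ 2 * rho ^+ 2)))).
    rewrite ler_pM2l //; apply: le_trans (ler_norm _) _; apply: le_trans Dh _.
    rewrite (_ : 9 * _ * _ * _ = 3 * gamma * (C * rho) * (3 * L * C * rho)); last by ring.
    by rewrite ler_pM2l // !mulr_gt0.
  rewrite C2 (_ : s * _ = 18 * gamma * L * (s * rho ^+ 2)); last by ring.
  by rewrite sr; move: gL; lra.
have Dt : Delta ^+ 2 <= 18 * gamma ^+ 2 * rho ^+ 2 * t ^+ 2.
  have -> : 18 * gamma ^+ 2 * rho ^+ 2 * t ^+ 2 = (3 * gamma * (C * rho) * t) ^+ 2.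
    by rewrite !exprMn C2; ring.
  rewrite -real_normK ?num_real // ler_pXn2r ?nnegrE //.
    by apply: le_trans Dh _; rewrite ler_pM2l // !mulr_gt0.
  by rewrite !mulr_ge0 ?(ltW gam0) ?(ltW C0) ?(ltW rho0) // norm2_ge0.
(* Passing to the unclipped error, whose mean vanishes, costs the inner product of
   [g - clip g lambda] with [v], at most [t ^+ 2 / (2 * lambda) * (C * rho) = t ^+ 2 / (4 * L)]. *)
have Dl : Delta <= - 2 * gamma * dot (g - mu) v +
    (gamma / (2 * L) + 2 * gamma ^+ 2) * t ^+ 2.
  have thE : th = (g - mu) - (g - clip g lambda).
    by rewrite /th opprB [RHS]addrC addrA subrK.
  rewrite /Delta [in dot th v]thE [dot (g - mu - _) v]dotDl [dot (- _) v]dotNl.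
  have E1 : `|dot (g - clip g lambda) v| <= t ^+ 2 / (2 * lambda) * (C * rho).
    apply: le_trans (normr_dot_le _ _) _.
    by apply: ler_pM; rewrite ?norm2_ge0 //; exact: norm2_subr_clip_le.
  have E2 : t ^+ 2 / (2 * lambda) * (C * rho) = t ^+ 2 / (4 * L).
    by rewrite /lambda /clip_level; field; rewrite !gt_eqF.
  have E3 : h ^+ 2 <= t ^+ 2 by rewrite ler_pXn2r ?nnegrE // norm2_ge0.
  have E4 : dot (g - clip g lambda) v <= t ^+ 2 / (4 * L).
    by rewrite -E2; apply: le_trans E1; exact: ler_norm.
  have E5 := ler_wpM2l (ltW gam0) E4.
  have E6 := ler_wpM2l (sqr_ge0 gamma) E3.
  have -> : gamma / (2 * L) = 2 * (gamma / (4 * L)).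
    by field; rewrite gt_eqF.
  by rewrite mulrDl; nra.
apply: le_trans (_ : expR (s * Delta) <= _).
  by rewrite ler_expR ler_pM2l.
apply: le_trans (expR_le_quadratic sD2) _.
have E1 := ler_wpM2l (ltW s0) Dl.
(* The whole coefficient of [t ^+ 2]: the first summand comes from [s * Delta], the second from
   [2 * (s * Delta) ^+ 2]. Relative to the target it is [1 / 4 + 1 / (80 * l) + 72 / 160 < 1]. *)
have K : s * (gamma / (2 * L) + 2 * gamma ^+ 2) + 36 * s ^+ 2 * gamma ^+ 2 * rho ^+ 2
    <= (20 * L ^+ 2 * rho ^+ 2)^-1.
  have -> : s * (gamma / (2 * L) + 2 * gamma ^+ 2) + 36 * s ^+ 2 * gamma ^+ 2 * rho ^+ 2
    = (20 * L ^+ 2 * rho ^+ 2)^-1 * (1 / 4 + 1 / (80 * l) + 72 / 160).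
    by rewrite /s /gamma; field; rewrite !gt_eqF.
  apply: ler_piMr; first by rewrite invr_ge0 !mulr_ge0 ?exprn_ge0 ?(ltW L0) ?(ltW rho0).
  have : 1 / (80 * l) <= 1 / 80.
    by rewrite ler_pM2l // lef_pV2 ?posrE ?mulr_gt0 //; lra.
  lra.
have {}K := ler_wpM2r (sqr_ge0 t) K.
have E3 : (s * Delta) ^+ 2 <= s ^+ 2 * (18 * gamma ^+ 2 * rho ^+ 2 * t ^+ 2).
  by rewrite exprMn ler_wpM2l ?sqr_ge0.
apply: (@le_trans _ _ (1 + s * (- 2 * gamma * dot (g - mu) v +
  (gamma / (2 * L) + 2 * gamma ^+ 2) * t ^+ 2) +
  2 * (s ^+ 2 * (18 * gamma ^+ 2 * rho ^+ 2 * t ^+ 2)))).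
  by apply: lerD; [rewrite lerD2l|rewrite ler_pM2l].
rewrite -[leRHS](subrK (1 - 2 * s * gamma * dot (g - mu) v)) -lerBlDr.
apply: le_trans (le_trans K _); rewrite le_eqVlt; apply/orP; left; apply/eqP; ring.
Qed.

(** * Convex smooth functions *)

Lemma derive_dot_grad (R : realType) (n : nat) (f : 'rV[R]_n -> R) (x v : 'rV[R]_n) :
  differentiable f x -> 'D_v f x = dot (grad f x) v.
Proof.
move=> df; rewrite deriveE // [in LHS](row_sum_delta v) linear_sum.
by apply: eq_bigr => i _; rewrite linearZ /= mxE mulrC deriveE.
Qed.

Lemma is_derive_line (R : realType) (n : nat) (f : 'rV[R]_n -> R)
    (x v : 'rV[R]_n) (t : R) :
  differentiable f (x + t *: v) ->
  is_derive t 1 (fun s : R => f (x + s *: v)) (dot (grad f (x + t *: v)) v).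
Proof.
move=> df; set phi := fun s : R => _.
have E : (fun h : R => h^-1 *: ((phi \o shift t) (h *: 1) - phi t)) =
         (fun h : R => h^-1 *: ((f \o shift (x + t *: v)) (h *: v) - f (x + t *: v))).
  apply/funext => h; rewrite /phi /=; congr (_ *: (f _ - _)).
  by rewrite scalerDl addrCA /GRing.scale /= mulr1.
have dv : derivable f (x + t *: v) v by exact: diff_derivable.
apply: DeriveDef; first by rewrite /derivable E.
by rewrite /derive E -(derive_dot_grad v df).
Qed.

Lemma convex_function_le (R : realType) (n : nat) (f : 'rV[R]_n -> R)
    (x y : 'rV[R]_n) (t : R) :
  convex_function [set: convex_lmodType 'rV[R]_n] f -> 0 <= t <= 1 ->
  f (t *: x + (1 - t) *: y) <= t * f x + (1 - t) * f y.
Proof.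
move=> cf t01; have t01' : Itv.spec (@Itv.num_sem R) (Itv.Real `[0%Z, 1%Z]) t.
  rewrite /Itv.spec /= /Itv.num_sem /= num_real /= in_itv /=.
  by case/andP: t01 => -> ->.
by have := cf (Itv.mk t01') x y (in_setT _) (in_setT _).
Qed.

(** Jensen's inequality for uniform weights, by induction: the mean of [N.+2] points combines the
    mean of the first [N.+1], with weight [t], and the last point. *)
Lemma convex_mean_le (R : realType) (n N : nat) (f : 'rV[R]_n -> R)
    (x : nat -> 'rV[R]_n) :
  convex_function [set: convex_lmodType 'rV[R]_n] f -> (0 < N)%N ->
  f (N%:R^-1 *: \sum_(k < N) x k) <= N%:R^-1 * \sum_(k < N) f (x k).
Proof.
move=> cf; case: N => // N _; elim: N => [|N IH].
  by rewrite !big_ord1 invr1 scale1r mul1r.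
rewrite 2!(big_ord_recr N.+1) /=.
set t : R := N.+1%:R / N.+2%:R.
have N1 : N.+1%:R != 0 :> R by rewrite pnatr_eq0.
have N2 : N.+2%:R != 0 :> R by rewrite pnatr_eq0.
have NE : N.+2%:R = N.+1%:R + 1 :> R by rewrite natr1.
have t1 : 1 - t = N.+2%:R^-1.
  by apply: (mulIf N2); rewrite mulrBl mulVf // divfK // mul1r NE addrAC subrr add0r.
have tN : N.+2%:R^-1 = t * N.+1%:R^-1 by rewrite /t mulrAC divff // mul1r.
rewrite scalerDr mulrDr {1}tN -t1 -scalerA.
apply: le_trans (convex_function_le _ _ cf _) _.
  rewrite /t divr_ge0 ?ler0n //= ler_pdivrMr ?ltr0n // mul1r ler_nat.
  exact: leqnSn.
rewrite lerD2r t1 tN -[leRHS]mulrA; apply: ler_wpM2l => //.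
by rewrite /t divr_ge0 ?ler0n.
Qed.

(** Convexity bounds the difference quotients at [x] towards [y] with step [0 < h <= 1] by
    [f y - f x], and the bound passes to the limit from the right. *)
Lemma convex_grad_le (R : realType) (n : nat) (f : 'rV[R]_n -> R) (x y : 'rV[R]_n) :
  convex_function [set: convex_lmodType 'rV[R]_n] f -> differentiable f x ->
  f x - f y <= dot (grad f x) (x - y).
Proof.
move=> cf df; rewrite -[x - y]opprB dotNr lerNr opprB -derive_dot_grad //.
have dv : derivable f x (y - x) by exact: diff_derivable.
move: (cvg_dnbhs_at_right dv); rewrite -/(derive f x (y - x)) => c.
apply: (cvgr_to_le c); near=> h.
have h0 : 0 < h by near: h; exact: nbhs_right_gt.
have h1 : h <= 1 by near: h; apply: nbhs_right_le; exact: ltr01.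
rewrite /= /GRing.scale /= ler_pdivrMl // lerBlDr.
have -> : h *: (y - x) + x = h *: y + (1 - h) *: x.
  by rewrite scalerBr scalerBl scale1r -addrA [- _ + _]addrC.
apply: le_trans (convex_function_le _ _ cf _) _; first by rewrite (ltW h0).
by rewrite le_eqVlt; apply/orP; left; apply/eqP; ring.
Unshelve. all: by end_near. Qed.

(** The descent lemma, by the mean value theorem for [q] on the unit interval. The Lipschitz bound
    makes [dq] nonpositive there; having the quadratic term inside [q] yields the factor [L / 2]
    without integration. *)
Lemma smooth_quadratic_upper_bound (R : realType) (n : nat) (L : R)
    (f : 'rV[R]_n -> R) (x v : 'rV[R]_n) :
  smooth L f -> f (x + v) <= f x + dot (grad f x) v + L / 2 * norm2 v ^+ 2.
Proof.
move=> [df sf].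
pose q : R -> R := fun t => f (x + t *: v) - t * dot (grad f x) v -
  L / 2 * norm2 v ^+ 2 * t ^+ 2.
pose dq : R -> R := fun t => dot (grad f (x + t *: v)) v - dot (grad f x) v -
  L * norm2 v ^+ 2 * t.
have iq (t : R) : is_derive t 1 q (dq t).
  have i1 := @is_derive_line _ _ f x v t (df _).
  rewrite /q; apply: is_derive_eq.
  by rewrite /dq /GRing.scale /=; field.
have cq : {within `[0, 1], continuous q}.
  apply: continuous_subspaceT => t; apply: differentiable_continuous.
  by apply/derivable1_diffP; exact: (@ex_derive _ _ _ _ _ _ _ (iq t)).
have [c] := MVT ltr01 (fun t _ => iq t) cq.
rewrite in_itv /= => /andP[c0 _].
rewrite subr0 mulr1 /q scale1r scale0r addr0 => E.
have : dq c <= 0.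
  rewrite /dq subr_le0 -dotNl -dotDl; apply: le_trans (dot_le_norm2 _ _) _.
  have := sf (x + c *: v) x; rewrite [x + _ - x]addrAC subrr add0r norm2Z gtr0_norm // => h.
  apply: le_trans (ler_wpM2r (norm2_ge0 v) h) _.
  by rewrite le_eqVlt; apply/orP; left; apply/eqP; ring.
by rewrite -E; lra.
Qed.

(** A gradient step of length [L^-1] from [x] cannot reach a value below [f xs]. *)
Lemma sqr_norm2_grad_le (R : realType) (n : nat) (L : R) (f : 'rV[R]_n -> R)
    (x xs : 'rV[R]_n) :
  0 < L -> smooth L f -> minimizer f xs ->
  norm2 (grad f x) ^+ 2 <= 2 * L * (f x - f xs).
Proof.
move=> L0 sf mf.
have := smooth_quadratic_upper_bound x (- L^-1 *: grad f x) sf.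
rewrite dotZr -sqr_norm2 norm2Z normrN gtr0_norm ?invr_gt0 // exprMn => h.
have := le_trans (mf _) h => {}h.
have {}h := ler_wpM2l (ltW L0) h.
have E : L * (f x + - L^-1 * norm2 (grad f x) ^+ 2 +
  L / 2 * (L^-1 ^+ 2 * norm2 (grad f x) ^+ 2)) =
  L * f x - norm2 (grad f x) ^+ 2 / 2.
  by field; rewrite gt_eqF.
by rewrite E in h; lra.
Qed.

(** The preceding bound at [xs] itself shows that the gradient vanishes there. *)
Lemma norm2_grad_le (R : realType) (n : nat) (L : R) (f : 'rV[R]_n -> R)
    (x xs : 'rV[R]_n) :
  0 < L -> smooth L f -> minimizer f xs ->
  norm2 (grad f x) <= L * norm2 (x - xs).
Proof.
move=> L0 sf mf; have := sqr_norm2_grad_le xs L0 sf mf.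
rewrite subrr mulr0 => g0.
have g00 : norm2 (grad f xs) = 0.
  by apply/eqP; rewrite -(sqrf_eq0 (norm2 _)) eq_le g0 sqr_ge0.
have := norm2D_le (grad f x - grad f xs) (grad f xs).
by rewrite subrK g00 addr0 => /le_trans; apply; case: sf.
Qed.

(** * Borel measurability in coordinates *)

Lemma continuous_measurable_rV (R : realType) (n : nat) (f : 'rV[R]_n -> R) :
  continuous f -> measurable_fun setT (f : borel_rV R n -> R).
Proof.
move=> cf; apply: (measurability _ (RGenOInfty.measurableE R)) => //.
move=> /= _ [_ [x ->] <-]; rewrite setTI; apply: sub_gen_smallest => /=.
by apply: (open_comp (fun y _ => cf y)); exact: interval_open.
Qed.

(* Every open set is a countable union of boxes with rational centres and radii. *)
Lemma measurable_fun_rV (R : realType) (n : nat) (d : measure_display)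
    (T : measurableType d) (g : T -> 'rV[R]_n) :
  (forall i, measurable_fun setT (fun t => g t 0 i)) ->
  measurable_fun setT (g : T -> borel_rV R n).
Proof.
move=> mg; apply: (@measurability _ _ T (borel_rV R n) setT g (@open 'rV[R]_n)) => //.
move=> _ [U oU <-]; rewrite setTI.
pose box (p : 'rV[rat]_n * rat) : set 'rV[R]_n :=
  [set y | forall i, `|y 0 i - ratr (p.1 0 i)| < ratr p.2].
(* Boxes not inside [U] are replaced by the empty set, so the union runs over a countable type. *)
pose F p := if pselect (box p `<=` U) then g @^-1` box p else set0.
have -> : g @^-1` U = \bigcup_p F p.
  apply/seteqP; split=> [t Ut|t [p _]]; last first.
    by rewrite /F; case: pselect => // pU /pU.
  have : nbhs (g t) U by apply: open_nbhs_nbhs; split.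
  move=> /nbhs_ballP [e /= e0 eU].
  (* A radius below [e / 2] suffices: points of the box are within [2 * r] of [g t] in each
     coordinate. *)
  have [r] := @rat_in_itvoo R 0 (e / 2) (divr_gt0 e0 (ltr0n R 2)).
  rewrite in_itv /= => /andP[r0 re].
  have qP i : exists q : rat, `|g t 0 i - ratr q| < ratr r :> R.
    have lt_r : g t 0 i - ratr r < g t 0 i + ratr r by lra.
    have [q] := rat_in_itvoo lt_r.
    by rewrite in_itv /= -ltr_distl distrC => ?; exists q.
  have [q qr] := choice qP.
  exists (\row_i q i, r) => //; rewrite /F; case: pselect => [_ i|[]].
    by rewrite /= mxE.
  move=> y yb; apply: eU; split => // i j; rewrite [i]ord1 {i} /ball /=.
  have := yb j; rewrite /= mxE => yj.
  have := ler_distD (ratr (q j)) (g t 0 j) (y 0 j).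
  by have := qr j; rewrite (distrC (ratr (q j))); lra.
apply: countable_bigcupT_measurable => [|p]; first exact: countableP.
rewrite /F; case: (pselect (box p `<=` U)) => [?|?]; last exact: measurable0.
have -> : g @^-1` box p =
    \bigcap_(i in [set: 'I_n]) [set t | `|g t 0 i - ratr (p.1 0 i)| < ratr p.2].
  by apply/seteqP; split=> t /= h i; [move=> _; exact: h|exact: h].
apply: fin_bigcap_measurable => [|i _]; first exact: finite_finset.
rewrite -[X in measurable X]setTI.
apply: (measurable_fun_ltr (f := fun t => `|g t 0 i - ratr (p.1 0 i)|)
  (g := cst (ratr p.2))) => //.
by apply: measurableT_comp => //; apply: measurable_funB.
Qed.

Lemma measurable_coord (R : realType) (n : nat) (d : measure_display)
    (T : measurableType d) (g : T -> 'rV[R]_n) (i : 'I_n) :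
  measurable_fun setT (g : T -> borel_rV R n) ->
  measurable_fun setT (fun t => g t 0 i).
Proof.
move=> mg.
apply: (measurableT_comp (f := fun x : borel_rV R n => (x : 'rV[R]_n) 0 i)) mg.
by apply: continuous_measurable_rV; exact: coord_continuous.
Qed.

(** * Independence *)

(** By independence the law of the pair agrees with the product of the two laws on rectangles, hence
    everywhere; Tonelli's theorem then separates the integrals. *)
Lemma integral_independent_pair (R : realType) (d d1 d2 : measure_display)
    (Omega : measurableType d) (T1 : measurableType d1) (T2 : measurableType d2)
    (P : probability Omega R) (A : {RV P >-> T1}) (B : {RV P >-> T2})
    (h : T1 * T2 -> \bar R) :
  (forall S1 S2, measurable S1 -> measurable S2 ->
    P (A @^-1` S1 `&` B @^-1` S2) = P (A @^-1` S1) * P (B @^-1` S2))%E ->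
  measurable_fun setT h -> (forall x, 0 <= h x)%E ->
  (\int[P]_w h (A w, B w) = \int[P]_w \int[P]_w' h (A w, B w'))%E.
Proof.
move=> iAB mh h0.
pose AB0 w := (A w, B w).
have mAB : measurable_fun setT AB0.
  by apply: measurable_fun_pair; exact: measurable_funPT.
pose AB : {RV P >-> (T1 * T2)%type} :=
  HB.pack AB0 (isMeasurableFun.Build _ _ _ _ AB0 mAB).
rewrite -(ge0_integral_distribution AB) //.
rewrite (eq_measure_integral (distribution P A \x distribution P B)%E); last first.
  by move=> S mS _; apply/esym; apply: product_measure_unique.
rewrite fubini_tonelli1 //.
rewrite ge0_integral_distribution; last 2 first.
- exact: measurable_fun_fubini_tonelli_F.
- by move=> x; exact: integral_ge0.
apply: eq_integral => w _; rewrite /fubini_F /=.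
rewrite ge0_integral_distribution //.
exact: measurableT_comp.
Qed.

(** The bound [g] on the inner integral plays the role of a bound on the conditional expectation
    given [A]. *)
Lemma integral_independent_pair_le (R : realType) (d d1 d2 : measure_display)
    (Omega : measurableType d) (T1 : measurableType d1) (T2 : measurableType d2)
    (P : probability Omega R) (A : {RV P >-> T1}) (B : {RV P >-> T2})
    (h : T1 * T2 -> \bar R) (g : Omega -> \bar R) :
  (forall S1 S2, measurable S1 -> measurable S2 ->
    P (A @^-1` S1 `&` B @^-1` S2) = P (A @^-1` S1) * P (B @^-1` S2))%E ->
  measurable_fun setT h -> (forall x, 0 <= h x)%E -> measurable_fun setT g ->
  (forall w, \int[P]_w' h (A w, B w') <= g w)%E ->
  (\int[P]_w h (A w, B w) <= \int[P]_w g w)%E.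
Proof.
move=> iAB mh h0 mg hg; rewrite integral_independent_pair //.
have -> : (fun w => \int[P]_w' h (A w, B w'))%E =
    fubini_F (distribution P B) h \o A.
  apply/funext => w; rewrite /fubini_F /= ge0_integral_distribution //.
  exact: measurableT_comp.
apply: ge0_le_integral => //.
- by move=> w _; exact: integral_ge0.
- apply: measurableT_comp => //; exact: measurable_fun_fubini_tonelli_F.
- move=> w _; apply: le_trans (hg w).
  rewrite /fubini_F /= ge0_integral_distribution //.
  exact: measurableT_comp.
Qed.

Lemma integral_prod_mul (R : realType) (d d' : measure_display)
    (T1 : measurableType d) (T2 : measurableType d')
    (P : probability T1 R) (Q : probability T2 R) (a : T1 -> R) (b : T2 -> R) :
  P.-integrable setT (EFin \o a) -> Q.-integrable setT (EFin \o b) ->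
  (P \x Q)%E.-integrable setT (fun z => (a z.1 * b z.2)%:E) /\
  (\int[P \x Q]_z (a z.1 * b z.2)%:E =
   \int[P]_x (a x)%:E * \int[Q]_y (b y)%:E)%E.
Proof.
move=> ia ib.
have ma : measurable_fun setT a by apply/measurable_EFinP; exact: measurable_int ia.
have mb : measurable_fun setT b by apply/measurable_EFinP; exact: measurable_int ib.
have fb : (\int[Q]_y (b y)%:E \is a fin_num)%E by exact: integrable_fin_num.
have iab : (P \x Q)%E.-integrable setT (fun z => (a z.1 * b z.2)%:E).
  apply/integrable12ltyP.
    apply/measurable_EFinP; apply: measurable_funM.
      by apply: measurableT_comp => //; exact: measurable_fst.
    by apply: measurableT_comp => //; exact: measurable_snd.
  have /integrableP[_ iboo] := ib; have /integrableP[_ iaoo] := ia.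
  have -> : (\int[P]_x \int[Q]_y `|(a x * b y)%:E| =
      \int[P]_x `|(a x)%:E| * \int[Q]_y `|(b y)%:E|)%E.
    rewrite -ge0_integralZr //; last 2 first.
    - by apply/measurableT_comp/measurable_EFinP.
    - exact: integral_ge0.
    apply: eq_integral => x _; rewrite -ge0_integralZl //; last first.
      by apply/measurableT_comp/measurable_EFinP.
    by apply: eq_integral => y _; rewrite EFinM abseM.
  by apply: lte_mul_pinfty; rewrite ?integral_ge0 ?ge0_fin_numE ?integral_ge0.
split=> //; rewrite -integral12_prod_meas1 //.
rewrite -(fineK fb) -integralZr //; apply: eq_integral => x _.
by rewrite /fubini_F /= fineK // -integralZl.
Qed.

(** The formula for product measures, carried over to [P] through the law of the pair. It removes
    the cross terms from the variance of a minibatch. *)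
Lemma integral_independent_mul (R : realType) (d d' : measure_display)
    (Omega : measurableType d) (Z : measurableType d')
    (P : probability Omega R) (X Y : {RV P >-> Z}) (a b : Z -> R) :
  (forall A B, measurable A -> measurable B ->
    P (X @^-1` A `&` Y @^-1` B) = P (X @^-1` A) * P (Y @^-1` B))%E ->
  measurable_fun setT a -> measurable_fun setT b ->
  P.-integrable setT (EFin \o (a \o X)) -> P.-integrable setT (EFin \o (b \o Y)) ->
  P.-integrable setT (fun w => (a (X w) * b (Y w))%:E) /\
  (\int[P]_w (a (X w) * b (Y w))%:E =
   \int[P]_w (a (X w))%:E * \int[P]_w (b (Y w))%:E)%E.
Proof.
move=> iXY ma mb ia ib.
pose XY0 w := (X w, Y w).
have mXY : measurable_fun setT XY0.
  by apply: measurable_fun_pair; exact: measurable_funPT.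
pose XY : {RV P >-> (Z * Z)%type} :=
  HB.pack XY0 (isMeasurableFun.Build _ _ _ _ XY0 mXY).
pose h (z : Z * Z) := (a z.1 * b z.2)%:E.
have mh : measurable_fun setT h.
  apply/measurable_EFinP; apply: measurable_funM.
    by apply: measurableT_comp => //; exact: measurable_fst.
  by apply: measurableT_comp => //; exact: measurable_snd.
have XYE S : measurable S ->
    distribution P XY S = (distribution P X \x distribution P Y)%E S.
  by move=> mS; apply/esym; apply: product_measure_unique.
have [||iab eab] := @integral_prod_mul _ _ _ _ _ (distribution P X) (distribution P Y) a b.
- by apply: integrable_pushforward => //; exact/measurable_EFinP.
- by apply: integrable_pushforward => //; exact/measurable_EFinP.
have ih : P.-integrable setT (h \o XY).
  apply/integrableP; split; first exact: measurableT_comp.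
  have /integrableP[_] := iab.
  rewrite -(eq_measure_integral _ (fun S mS _ => XYE S mS)).
  by rewrite ge0_integral_distribution //; exact: measurableT_comp.
split; first exact: ih.
move: eab; rewrite -(eq_measure_integral _ (fun S mS _ => XYE S mS)).
rewrite !integral_distribution //; exact/measurable_EFinP.
Qed.

(** For fixed [B] both sides are finite measures in [A]. They agree on the pi-system [G], hence on
    the sigma-algebra it generates. *)
Lemma probabilityI_gen (R : realType) (d : measure_display) (Omega : measurableType d)
    (P : probability Omega R) (G : set (set Omega)) (B : set Omega) :
  setI_closed G -> G `<=` measurable -> G setT -> measurable B ->
  (forall A, G A -> P (A `&` B) = P A * P B)%E ->
  forall A, <<s G >> A -> (P (A `&` B) = P A * P B)%E.
Proof.
move=> GI Gm GT mB GB A sA.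
have PBE : P B = (fine (P B))%:E by rewrite fineK // fin_num_measure.
pose p : {nonneg R} := NngNum (fine_ge0 (measure_ge0 P B)).
suff : mrestr P mB A = mscale p P A by rewrite /mscale /mrestr /= -PBE muleC.
apply: (@g_sigma_algebra_measure_unique _ _ _ G Gm (fun=> setT)) => //.
- by rewrite bigcup_const //; exists 0%N.
- by move=> E GE; rewrite /= /mscale /mrestr /= GB // -PBE muleC.
- move=> _; rewrite /= /mrestr setTI; apply: le_lt_trans (probability_le1 P mB) _.
  exact: ltry.
Qed.

Lemma probabilityI_gen2 (R : realType) (d : measure_display) (Omega : measurableType d)
    (P : probability Omega R) (G H : set (set Omega)) :
  setI_closed G -> G `<=` measurable -> G setT ->
  setI_closed H -> H `<=` measurable -> H setT ->
  (forall A B, G A -> H B -> P (A `&` B) = P A * P B)%E ->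
  forall A B, <<s G >> A -> <<s H >> B -> (P (A `&` B) = P A * P B)%E.
Proof.
move=> GI Gm GT HI Hm HT GH A B sA sB.
have mB : measurable B by apply: smallest_sub sB => //; exact: sigma_algebra_measurable.
apply: (probabilityI_gen GI Gm GT mB) sA => {}A GA.
rewrite setIC muleC; apply: (probabilityI_gen HI Hm HT (Gm _ GA)) sB => {mB}B HB.
by rewrite setIC muleC; exact: GH.
Qed.

(** A pi-system generating the sigma-algebra of the [X i] with [i] in [S]; the finite index sets
    match those of [mutually_independent]. *)
Definition cylinders (T Z : Type) (measZ : set (set Z)) (I : choiceType)
    (X : I -> T -> Z) (S : set I) : set (set T) :=
  [set E | exists (J : {fset I}) (B : I -> set Z), [/\ [set` J] `<=` S,
     forall i, measZ (B i) & E = \bigcap_(i in [set` J]) X i @^-1` B i]].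

Lemma cylindersT (d : measure_display) (T : Type) (Z : measurableType d)
    (I : choiceType) (X : I -> T -> Z) (S : set I) :
  cylinders measurable X S setT.
Proof.
by exists fset0, (fun=> setT); split=> //; rewrite set_fset0 bigcap_set0.
Qed.

Lemma cylinders_preimage (d : measure_display) (T : Type) (Z : measurableType d)
    (I : choiceType) (X : I -> T -> Z) (S : set I) (i : I) (B : set Z) :
  S i -> measurable B -> cylinders measurable X S (X i @^-1` B).
Proof.
move=> Si mB; exists [fset i]%fset, (fun=> B); split=> //.
  by move=> j /=; rewrite inE => /eqP ->.
by rewrite set_fset1 bigcap_set1.
Qed.

Lemma cylindersI (d : measure_display) (T : Type) (Z : measurableType d)
    (I : choiceType) (X : I -> T -> Z) (S : set I) :
  setI_closed (cylinders measurable X S).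
Proof.
move=> _ _ [J [B [JS mB ->]]] [J' [B' [JS' mB' ->]]].
(* An index missing from one of the two sets is unconstrained there, hence [setT]. *)
exists (J `|` J')%fset, (fun i => (if i \in J then B i else setT) `&`
  (if i \in J' then B' i else setT)); split.
- by move=> i /=; rewrite inE => /orP[/JS|/JS'].
- by move=> i; apply: measurableI; case: ifP.
- apply/seteqP; split=> t /=.
    by move=> [h h'] i /=; rewrite inE => _; split; case: ifP => // ?; [exact: h|exact: h'].
  move=> h; split=> i /= iJ.
    by have [] := h i; rewrite /= ?inE ?iJ.
  by have [] := h i; rewrite /= ?inE ?iJ ?orbT.
Qed.

(** As the index sets are disjoint, the intersection is one cylinder over their union, and the
    product given by mutual independence splits in two. *)
Lemma cylinders_independent (R : realType) (d d' : measure_display)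
    (Omega : measurableType d) (Z : measurableType d') (P : probability Omega R)
    (I : choiceType) (S S1 S2 : set I) (X : I -> {RV P >-> Z}) :
  mutually_independent S X -> S1 `<=` S -> S2 `<=` S -> S1 `&` S2 = set0 ->
  forall A B, cylinders measurable X S1 A -> cylinders measurable X S2 B ->
  (P (A `&` B) = P A * P B)%E.
Proof.
move=> mi S1S S2S S12 _ _ [J [B [JS mB ->]]] [J' [B' [JS' mB' ->]]].
have JJ' i : i \in J -> i \notin J'.
  move=> iJ; apply/negP => iJ'.
  by have : (S1 `&` S2) i; [split; [exact: JS|exact: JS']|rewrite S12].
pose B0 i := if i \in J then B i else B' i.
have -> : \bigcap_(i in [set` J]) X i @^-1` B i `&`
    \bigcap_(i in [set` J']) X i @^-1` B' i =
    \bigcap_(i in [set` (J `|` J')%fset]) X i @^-1` B0 i.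
  apply/seteqP; split=> t /=.
    move=> [h h'] i /=; rewrite inE /B0; case: ifP => [iJ _|_ /= iJ'].
      exact: h.
    exact: h'.
  move=> h; split=> i /= iJ.
    by have := h i; rewrite /B0 /= inE iJ; exact.
  have := h i; rewrite /B0 /= inE iJ orbT => /(_ isT).
  by case: ifP => // /JJ'; rewrite iJ.
rewrite !mi; first last.
- by move=> i; rewrite /B0; case: ifP.
- by move=> i /=; rewrite inE => /orP[/JS/S1S|/JS'/S2S].
- exact: mB.
- exact: (subset_trans JS).
- exact: mB'.
- exact: (subset_trans JS').
rewrite (perm_big (J ++ J')) /=; last first.
  apply: uniq_perm; first exact: fset_uniq.
    rewrite cat_uniq !fset_uniq andbT /=; apply/hasPn => i iJ'.
    by apply/negP => /JJ'; rewrite iJ'.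
  by move=> i; rewrite mem_cat inE.
rewrite big_cat /=.
by congr (_ * _)%E; apply: eq_big_seq => i iJ; rewrite /B0 ?iJ //;
  case: ifP => // /JJ'; rewrite iJ.
Qed.

Lemma measurable_cylinders (R : realType) (d d' : measure_display)
    (Omega : measurableType d) (Z : measurableType d') (P : probability Omega R)
    (I : choiceType) (S : set I) (X : I -> {RV P >-> Z}) :
  cylinders measurable X S `<=` measurable.
Proof.
move=> _ [J [B [_ mB ->]]]; apply: fin_bigcap_measurable => // i _.
by rewrite -[X in measurable X]setTI; exact: measurable_funPT.
Qed.

(* In a function of the samples with index in [S1] and, separately, of those with
   index in [S2], the second argument may be integrated with the first frozen. *)
Lemma integral_freeze_le (R : realType) (d d' : measure_display)
    (Omega : measurableType d) (Z : measurableType d') (P : probability Omega R)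
    (I : choiceType) (S S1 S2 : set I) (X : I -> {RV P >-> Z})
    (G1 := cylinders measurable X S1) (G2 := cylinders measurable X S2)
    (h : g_sigma_algebraType G1 * g_sigma_algebraType G2 -> \bar R)
    (g : Omega -> \bar R) :
  mutually_independent S X -> S1 `<=` S -> S2 `<=` S -> S1 `&` S2 = set0 ->
  measurable_fun setT h -> (forall x, 0 <= h x)%E -> measurable_fun setT g ->
  (forall w, \int[P]_w' h (w, w') <= g w)%E ->
  (\int[P]_w h (w, w) <= \int[P]_w g w)%E.
Proof.
move=> mi S1S S2S S12 mh h0 mg hg.
have sm S' : <<s cylinders measurable X S' >> `<=` @measurable _ Omega.
  apply: smallest_sub; first exact: sigma_algebra_measurable.
  exact: measurable_cylinders.
have mid S' : @measurable_fun _ _ Omega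
    (g_sigma_algebraType (cylinders measurable X S')) setT id.
  by move=> _ Y mY; rewrite setTI; exact: (sm S' Y mY).
(* [A] and [B] are both the identity of [Omega], seen as maps into the coarser sigma-algebras of the
   two groups of samples. *)
pose A : {RV P >-> g_sigma_algebraType G1} :=
  HB.pack (id : Omega -> g_sigma_algebraType G1)
    (isMeasurableFun.Build _ _ _ _ _ (mid S1)).
pose B : {RV P >-> g_sigma_algebraType G2} :=
  HB.pack (id : Omega -> g_sigma_algebraType G2)
    (isMeasurableFun.Build _ _ _ _ _ (mid S2)).
apply: (integral_independent_pair_le (A := A) (B := B)) => // E F mE mF.
apply: (@probabilityI_gen2 _ _ _ P G1 G2) => //; try exact: cylindersI;
  try exact: cylindersT; try exact: measurable_cylinders.
exact: (cylinders_independent mi S1S S2S S12).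
Qed.

Lemma measurable_fun_cylinders (d : measure_display) (T : pointedType)
    (Z : measurableType d) (I : choiceType) (X : I -> T -> Z) (S : set I) (i : I) :
  S i ->
  measurable_fun setT (X i : g_sigma_algebraType (cylinders measurable X S) -> Z).
Proof.
move=> Si _ B mB; rewrite setTI; apply: sub_gen_smallest.
exact: cylinders_preimage.
Qed.

(** * Moments of minibatches *)

(** Integrability and value are kept together, so that sums and multiples raise no separate
    integrability conditions. *)
Definition has_mean (R : realType) (d : measure_display) (T : measurableType d)
    (P : probability T R) (X : T -> R) (r : R) : Prop :=
  P.-integrable setT (EFin \o X) /\ (\int[P]_w (X w)%:E = r%:E)%E.

Lemma has_mean_cst (R : realType) (d : measure_display) (T : measurableType d)
    (P : probability T R) (r : R) : has_mean P (fun=> r) r.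
Proof.
split; first exact: finite_measure_integrable_cst.
by have := expectation_cst P r; rewrite unlock.
Qed.

Lemma has_meanD (R : realType) (d : measure_display) (T : measurableType d)
    (P : probability T R) (X Y : T -> R) (r s : R) :
  has_mean P X r -> has_mean P Y s -> has_mean P (fun w => X w + Y w) (r + s).
Proof.
move=> [iX EX] [iY EY]; split.
  by have := integrableD measurableT iX iY; exact.
under eq_integral do rewrite EFinD.
by rewrite integralD //= EX EY.
Qed.

Lemma has_meanZ (R : realType) (d : measure_display) (T : measurableType d)
    (P : probability T R) (a : R) (X : T -> R) (r : R) :
  has_mean P X r -> has_mean P (fun w => a * X w) (a * r).
Proof.
move=> [iX EX]; split; first by have := integrableZl measurableT a iX; exact.
under eq_integral do rewrite EFinM.
by rewrite integralZl //= EX.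
Qed.

Lemma has_mean_sum (R : realType) (d : measure_display) (T : measurableType d)
    (P : probability T R) (I : Type) (s : seq I) (X : I -> T -> R) (r : I -> R) :
  (forall i, has_mean P (X i) (r i)) ->
  has_mean P (fun w => \sum_(i <- s) X i w) (\sum_(i <- s) r i).
Proof.
move=> h; elim: s => [|i s IH].
  by rewrite big_nil; under eq_fun do rewrite big_nil; exact: has_mean_cst.
by rewrite big_cons; under eq_fun do rewrite big_cons; exact: has_meanD.
Qed.

Lemma has_mean_sqr (R : realType) (d : measure_display) (T : measurableType d)
    (P : probability T R) (X : T -> R) (b : R) :
  measurable_fun setT X -> (\int[P]_w (X w ^+ 2)%:E <= b%:E)%E ->
  exists r, has_mean P (fun w => X w ^+ 2) r.
Proof.
move=> mX Xb; exists (fine (\int[P]_w (X w ^+ 2)%:E)); split.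
  apply/integrableP; split; first by apply/measurable_EFinP; exact: measurable_funX.
  under eq_integral do rewrite /= ger0_norm ?sqr_ge0 //.
  by apply: le_lt_trans Xb _; exact: ltry.
rewrite fineK // ge0_fin_numE; first by apply: le_lt_trans Xb _; exact: ltry.
by apply: integral_ge0 => w _; rewrite lee_fin sqr_ge0.
Qed.

(** The absolute value of [X] is dominated by [1 + X ^+ 2]. *)
Lemma has_mean_integrable_sqr (R : realType) (d : measure_display)
    (T : measurableType d) (P : probability T R) (X : T -> R) (r : R) :
  measurable_fun setT X -> has_mean P (fun w => X w ^+ 2) r ->
  P.-integrable setT (EFin \o X).
Proof.
move=> mX hX; have [i1 _] := has_meanD (has_mean_cst P 1) hX.
apply: le_integrable i1 => //; first exact/measurable_EFinP.
move=> w _ /=; rewrite lee_fin [leRHS]ger0_norm ?addr_ge0 ?sqr_ge0 //.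
rewrite -real_normK ?num_real //.
by have := sqr_ge0 (`|X w| - 1); have := normr_ge0 (X w); nra.
Qed.

Lemma has_mean_distribution (R : realType) (d d' : measure_display)
    (T : measurableType d) (Z : measurableType d') (P : probability T R)
    (D : probability Z R) (X : {RV P >-> Z}) (g : Z -> R) (r : R) :
  (forall A, measurable A -> distribution P X A = D A) ->
  has_mean D g r -> has_mean P (g \o X) r.
Proof.
move=> XD [ig Eg].
have mg : measurable_fun setT (EFin \o g) by exact: measurable_int ig.
have ii : P.-integrable setT ((EFin \o g) \o X).
  apply/integrableP; split; first exact: measurableT_comp.
  rewrite -(ge0_integral_distribution X (f := fun z => `|(g z)%:E|%E)) //; last first.
    exact: measurableT_comp.
  rewrite (eq_measure_integral _ (fun A mA _ => XD A mA)).
  by have /integrableP[] := ig.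
split; first exact: ii.
rewrite -Eg -(eq_measure_integral _ (fun A mA _ => XD A mA)).
by rewrite (integral_distribution mg ii).
Qed.

Lemma minibatchB (R : realType) (n : nat) (Z : Type) (G : 'rV[R]_n -> Z -> 'rV[R]_n)
    (m : nat) (x mu : 'rV[R]_n) (z : nat -> Z) (c : 'I_n) :
  (0 < m)%N ->
  (minibatch G m x z - mu) 0 c = m%:R^-1 * \sum_(i < m) (G x (z i) 0 c - mu 0 c).
Proof.
move=> m0; rewrite !mxE summxE sumrB sumr_const card_ord mulrBr.
by rewrite -[mu 0 c *+ m]mulr_natl mulKf // pnatr_eq0 -lt0n.
Qed.

(** Each coordinate of the error averages [m] centred variables. Its mean vanishes by linearity; in
    its square the off-diagonal products have mean 0 by pairwise independence, and the [m] diagonal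
    ones leave the factor [m%:R^-1]. *)
Lemma minibatch_moments (R : realType) (n : nat) (f : 'rV[R]_n -> R) (sigma : R)
    (d d' : measure_display) (Z : measurableType d) (D : probability Z R)
    (Omega : measurableType d') (P : probability Omega R)
    (G : 'rV[R]_n -> Z -> 'rV[R]_n) (m : nat) (z : nat -> {RV P >-> Z})
    (x v : 'rV[R]_n) :
  stochastic_gradient D f sigma G -> (0 < m)%N ->
  (forall i, (i < m)%N -> forall A, measurable A -> distribution P (z i) A = D A) ->
  (forall i j, (i < m)%N -> (j < m)%N -> i != j ->
    forall A B, measurable A -> measurable B ->
    P (z i @^-1` A `&` z j @^-1` B) = P (z i @^-1` A) * P (z j @^-1` B))%E ->
  let err w := minibatch G m x (fun i => z i w) - grad f x in
  has_mean P (fun w => dot (err w) v) 0 /\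
  exists2 V, has_mean P (fun w => norm2 (err w) ^+ 2) V & V <= sigma ^+ 2 / m%:R.
Proof.
move=> [mG EG VG] m0 zD zI err.
pose y c t := G x t 0 c - grad f x 0 c.
have mGx c : measurable_fun setT (fun t => G x t 0 c).
  exact: (@measurable_fun_pair2 _ _ _ (borel_rV R n) Z _
    (fun p : borel_rV R n * Z => G p.1 p.2 0 c) x (mG c)).
have my c : measurable_fun setT (y c) by apply: measurable_funB => //.
have normE t : norm2 (G x t - grad f x) ^+ 2 = \sum_c y c t ^+ 2.
  by rewrite sqr_norm2; apply: eq_bigr => c _; rewrite -expr2 2!mxE.
have VGx := VG x; rewrite unlock /= in VGx.
have ysq c : exists r, has_mean D (fun t => y c t ^+ 2) r.
  apply: (has_mean_sqr (b := sigma ^+ 2)) => //; apply: le_trans VGx.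
  apply: ge0_le_integral => //.
  - by move=> t _; rewrite lee_fin sqr_ge0.
  - by apply/measurable_EFinP; exact: measurable_funX.
  - apply/measurable_EFinP; under eq_fun do rewrite normE.
    by apply: measurable_sum => k; exact: measurable_funX.
  - move=> t _; rewrite lee_fin normE (bigD1 c) //= lerDl.
    by apply: sumr_ge0 => k _; exact: sqr_ge0.
have [s hs] := choice ysq.
have s_le : \sum_c s c <= sigma ^+ 2.
  have [_ E] := has_mean_sum (index_enum 'I_n) hs.
  rewrite -lee_fin -E; apply: le_trans VGx.
  by under [leRHS]eq_integral do rewrite normE.
have hy c : has_mean D (y c) 0.
  (* Integrability of [y c] comes from that of its square; adding the constant back makes [G x]
     integrable, so that its expectation can be centred by linearity. *)
  have iy := has_mean_integrable_sqr (my c) (hs c).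
  split=> //; have := EG x c; rewrite unlock /= => E.
  have iG : D.-integrable setT (EFin \o (fun t => G x t 0 c)).
    have [i1 _] := has_mean_cst D (grad f x 0 c).
    have := integrableD measurableT iy i1; congr (D.-integrable _ _).
    by apply/funext => t; rewrite /= -EFinD subrK.
  have [_] := has_meanD (conj iG E) (has_mean_cst D (- grad f x 0 c)).
  by rewrite subrr.
have hyz c (i : 'I_m) : has_mean P (fun w => y c (z i w)) 0.
  by apply: (has_mean_distribution (zD i (ltn_ord i)) (hy c)).
have errE w c : err w 0 c = m%:R^-1 * \sum_(i < m) y c (z i w).
  exact: minibatchB.
split.
  have -> : 0 = \sum_c v 0 c * (m%:R^-1 * \sum_(i < m) 0) :> R.
    by rewrite big1_eq mulr0 big1 // => c _; rewrite mulr0.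
  rewrite (_ : (fun w => _) = fun w =>
      \sum_c v 0 c * (m%:R^-1 * \sum_(i < m) y c (z i w))).
    apply: has_mean_sum => c; apply: has_meanZ; apply: has_meanZ.
    exact: has_mean_sum.
  by apply/funext => w; apply: eq_bigr => c _; rewrite errE mulrC.
have hyy c (i j : 'I_m) :
    has_mean P (fun w => y c (z i w) * y c (z j w)) (if i == j then s c else 0).
  case: eqVneq => [->|ij].
    by apply: (has_mean_distribution (zD j (ltn_ord j)) (hs c)).
  have [i1 E1] := hyz c i; have [i2 E2] := hyz c j.
  have [I E] := integral_independent_mul (zI i j (ltn_ord i) (ltn_ord j) ij)
    (my c) (my c) i1 i2.
  by split; [exact: I|rewrite E E1 E2 mule0].
exists (\sum_c m%:R^-1 ^+ 2 * \sum_(i < m) \sum_(j < m) (if i == j then s c else 0)).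
  rewrite (_ : (fun w => _) = fun w => \sum_c m%:R^-1 ^+ 2 *
      \sum_(i < m) \sum_(j < m) y c (z i w) * y c (z j w)).
    apply: has_mean_sum => c; apply: has_meanZ.
    by apply: has_mean_sum => i; exact: has_mean_sum.
  apply/funext => w; rewrite sqr_norm2; apply: eq_bigr => c _.
  rewrite errE -expr2 exprMn; congr (_ * _).
  by rewrite expr2 mulr_suml; apply: eq_bigr => i _; rewrite mulr_sumr.
rewrite (_ : \sum_c _ = (\sum_c s c) / m%:R).
  by rewrite ler_pM2r // invr_gt0 ltr0n.
rewrite mulr_suml; apply: eq_bigr => c _.
rewrite (eq_bigr (fun=> s c)) => [|i _]; last first.
  by rewrite (bigD1 i) //= eqxx big1 ?addr0 // => j; rewrite eq_sym => /negbTE ->.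
rewrite sumr_const card_ord -[s c *+ m]mulr_natl expr2 -mulrA mulKf ?pnatr_eq0 -?lt0n //.
by rewrite mulrC.
Qed.

(** * The Lyapunov function *)

Lemma measurable_norm2 (R : realType) (n : nat) (d : measure_display)
    (T : measurableType d) (x : T -> 'rV[R]_n) :
  measurable_fun setT (x : T -> borel_rV R n) ->
  measurable_fun setT (fun t => norm2 (x t)).
Proof.
move=> mx; apply: (measurableT_comp (f := @Num.sqrt R)).
  by apply: continuous_measurable_fun; exact: sqrt_continuous.
by apply: measurable_sum => i; apply: measurable_funX; exact: measurable_coord.
Qed.

Lemma measurable_rVB (R : realType) (n : nat) (d : measure_display)
    (T : measurableType d) (x y : T -> 'rV[R]_n) :
  measurable_fun setT (x : T -> borel_rV R n) ->
  measurable_fun setT (y : T -> borel_rV R n) ->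
  measurable_fun setT ((fun t => x t - y t) : T -> borel_rV R n).
Proof.
move=> mx my; apply: measurable_fun_rV => i; under eq_fun do rewrite 2!mxE.
by apply: measurable_funB; exact: measurable_coord.
Qed.

Lemma measurable_rVZ (R : realType) (n : nat) (d : measure_display)
    (T : measurableType d) (a : T -> R) (x : T -> 'rV[R]_n) :
  measurable_fun setT a -> measurable_fun setT (x : T -> borel_rV R n) ->
  measurable_fun setT ((fun t => a t *: x t) : T -> borel_rV R n).
Proof.
move=> ma mx; apply: measurable_fun_rV => i; under eq_fun do rewrite mxE.
by apply: measurable_funM => //; exact: measurable_coord.
Qed.

Lemma measurable_rV_sum (R : realType) (n m : nat) (d : measure_display)
    (T : measurableType d) (x : 'I_m -> T -> 'rV[R]_n) :
  (forall i, measurable_fun setT (x i : T -> borel_rV R n)) ->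
  measurable_fun setT ((fun t => \sum_(i < m) x i t) : T -> borel_rV R n).
Proof.
move=> mx; apply: measurable_fun_rV => j; under eq_fun do rewrite summxE.
by apply: measurable_sum => i; exact: measurable_coord.
Qed.

Lemma measurable_clip (R : realType) (n : nat) (d : measure_display)
    (T : measurableType d) (x : T -> 'rV[R]_n) (lambda : R) :
  measurable_fun setT (x : T -> borel_rV R n) ->
  measurable_fun setT ((fun t => clip (x t) lambda) : T -> borel_rV R n).
Proof.
move=> mx; apply: measurable_rVZ => //; apply: measurable_minr => //.
apply: measurable_funM; first exact: measurable_cst.
(* The inverse is discontinuous at 0; it agrees with the power [-1] on all nonnegative reals, 0
   included. *)
have -> : (fun t => (norm2 (x t))^-1) = (@powR R ^~ (-1)) \o (fun t => norm2 (x t)).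
  by apply/funext => t; rewrite /= powR_inv1 ?norm2_ge0.
exact: (measurableT_comp (measurable_powR (-1)) (measurable_norm2 mx)).
Qed.

Lemma measurable_minibatch (R : realType) (n m : nat) (d d' : measure_display)
    (T : measurableType d) (Z : measurableType d') (G : 'rV[R]_n -> Z -> 'rV[R]_n)
    (x : T -> 'rV[R]_n) (z : T -> nat -> Z) :
  (forall i, measurable_fun setT (fun p : borel_rV R n * Z => G p.1 p.2 0 i)) ->
  measurable_fun setT (x : T -> borel_rV R n) ->
  (forall i, (i < m)%N -> measurable_fun setT (fun t => z t i)) ->
  measurable_fun setT ((fun t => minibatch G m (x t) (z t)) : T -> borel_rV R n).
Proof.
move=> mG mx mz; apply: measurable_rVZ => //; apply: measurable_rV_sum => i.
apply: measurable_fun_rV => j.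
apply: (measurableT_comp (f := fun p : borel_rV R n * Z => G p.1 p.2 0 j)
  (g := fun t => ((x t, z t i) : borel_rV R n * Z)) (mG j)).
by apply: measurable_fun_pair => //; apply: mz.
Qed.

Lemma measurable_clipped_sgd (R : realType) (n : nat) (d d' : measure_display)
    (T : measurableType d) (Z : measurableType d') (G : 'rV[R]_n -> Z -> 'rV[R]_n)
    (x0 : 'rV[R]_n) (m : nat -> nat) (gamma lambda : R) (z : T -> nat -> nat -> Z)
    (k : nat) :
  (forall i, measurable_fun setT (fun p : borel_rV R n * Z => G p.1 p.2 0 i)) ->
  (forall j i, (j < k)%N -> (i < m j)%N -> measurable_fun setT (fun t => z t j i)) ->
  measurable_fun setT
    ((fun t => clipped_sgd G x0 m gamma lambda (z t) k) : T -> borel_rV R n).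
Proof.
move=> mG; elim: k => [|k IH] mz /=.
  exact: (@measurable_cst _ _ T (borel_rV R n)).
have {}IH := IH (fun j i jk => mz j i (leqW jk)).
apply: measurable_rVB => //; apply: measurable_rVZ => //; apply: measurable_clip.
by apply: measurable_minibatch => // i ik; exact: mz.
Qed.

(* The Lyapunov function [|x_k - xs|^2 + gamma * sum_(j < k) (f x_j - f xs)],
   frozen as soon as it exceeds [b]. *)
Fixpoint potential (R : realType) (n : nat) (Z : Type)
    (f : 'rV[R]_n -> R) (xs : 'rV[R]_n) (b : R)
    (G : 'rV[R]_n -> Z -> 'rV[R]_n) (x0 : 'rV[R]_n) (m : nat -> nat)
    (gamma lambda : R) (z : nat -> nat -> Z) (k : nat) : R :=
  if k is k'.+1 then
    let u := potential f xs b G x0 m gamma lambda z k' in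
    let x := clipped_sgd G x0 m gamma lambda z k' in
    if b < u then u else
    u + (norm2 (x - xs - gamma *: clip (minibatch G (m k') x (z k')) lambda) ^+ 2
         - norm2 (x - xs) ^+ 2 + gamma * (f x - f xs))
  else norm2 (x0 - xs) ^+ 2.

Lemma measurable_potential (R : realType) (n : nat) (d d' : measure_display)
    (T : measurableType d) (Z : measurableType d')
    (f : 'rV[R]_n -> R) (xs : 'rV[R]_n) (b : R) (G : 'rV[R]_n -> Z -> 'rV[R]_n)
    (x0 : 'rV[R]_n) (m : nat -> nat) (gamma lambda : R) (z : T -> nat -> nat -> Z)
    (k : nat) :
  continuous f ->
  (forall i, measurable_fun setT (fun p : borel_rV R n * Z => G p.1 p.2 0 i)) ->
  (forall j i, (j < k)%N -> (i < m j)%N -> measurable_fun setT (fun t => z t j i)) ->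
  measurable_fun setT (fun t => potential f xs b G x0 m gamma lambda (z t) k).
Proof.
move=> cf mG; elim: k => [|k IH] mz /=; first exact: measurable_cst.
have mz' := fun j i jk => mz j i (leqW jk).
have {}IH := IH mz'.
have mx := measurable_clipped_sgd x0 gamma lambda mG mz'.
have mxs : measurable_fun setT ((fun t => clipped_sgd G x0 m gamma lambda (z t) k - xs)
    : T -> borel_rV R n).
  by apply: measurable_rVB => //; exact: (@measurable_cst _ _ T (borel_rV R n)).
apply: measurable_fun_ifT => //; first exact: measurable_fun_ltr.
apply: measurable_funD => //; apply: measurable_funD.
  apply: measurable_funB; apply: measurable_funX; apply: measurable_norm2 => //.
  apply: measurable_rVB => //; apply: measurable_rVZ => //; apply: measurable_clip.
  by apply: measurable_minibatch => // i ik; exact: mz.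
apply: measurable_funM => //; apply: measurable_funB => //.
apply: (measurableT_comp (f := f : borel_rV R n -> R)) => //.
exact: continuous_measurable_rV.
Qed.

(** Once above [b] the potential stays constant, so a value at most [b] means that it was never
    frozen, and the increments telescope. *)
Lemma potentialE (R : realType) (n : nat) (Z : Type)
    (f : 'rV[R]_n -> R) (xs : 'rV[R]_n) (b : R)
    (G : 'rV[R]_n -> Z -> 'rV[R]_n) (x0 : 'rV[R]_n) (m : nat -> nat)
    (gamma lambda : R) (z : nat -> nat -> Z) (k : nat) :
  potential f xs b G x0 m gamma lambda z k <= b ->
  potential f xs b G x0 m gamma lambda z k =
  norm2 (clipped_sgd G x0 m gamma lambda z k - xs) ^+ 2 +
  gamma * \sum_(j < k) (f (clipped_sgd G x0 m gamma lambda z j) - f xs).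
Proof.
elim: k => [|k IH] /=; first by rewrite big_ord0 mulr0 addr0.
case: (ltP b _) => [bu ub|ub _]; first by move: (lt_le_trans bu ub); rewrite ltxx.
rewrite IH // big_ord_recr /= mulrDr [X in norm2 X ^+ 2 - _]addrAC.
ring.
Qed.

Lemma iid_samples_pairwise (R : realType) (d d' : measure_display)
    (Omega : measurableType d) (Z : measurableType d') (P : probability Omega R)
    (D : probability Z R) (N : nat) (m : nat -> nat) (xi : nat -> nat -> {RV P >-> Z})
    (k i j : nat) :
  iid_samples D N m xi -> (k < N)%N -> (i < m k)%N -> (j < m k)%N -> i != j ->
  forall A B, measurable A -> measurable B ->
  (P (xi k i @^-1` A `&` xi k j @^-1` B) = P (xi k i @^-1` A) * P (xi k j @^-1` B))%E.
Proof.
move=> [_ mi] kN im jm ij A B mA mB.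
apply: (cylinders_independent mi (S1 := [set (k, i)]) (S2 := [set (k, j)])).
- by move=> _ ->; rewrite /= kN im.
- by move=> _ ->; rewrite /= kN jm.
- apply/seteqP; split=> // _ [-> /= [] ji].
  by move: ij; rewrite ji eqxx.
- exact: (@cylinders_preimage _ _ _ _ (fun ki => xi ki.1 ki.2) _ (k, i)).
- exact: (@cylinders_preimage _ _ _ _ (fun ki => xi ki.1 ki.2) _ (k, j)).
Qed.

(** Here [x] is a fixed point, as the iterate is once the past is frozen. Integrating the pointwise
    bound, the term linear in the error has mean 0, the quadratic one has mean at most [c], and
    [1 + c <= expR c]. *)
Lemma expectation_clipped_step_le (R : realType) (n : nat) (f : 'rV[R]_n -> R)
    (L sigma l rho C c : R) (d d' : measure_display) (Z : measurableType d)
    (D : probability Z R) (Omega : measurableType d') (P : probability Omega R)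
    (G : 'rV[R]_n -> Z -> 'rV[R]_n) (m : nat) (z : nat -> {RV P >-> Z})
    (x xs : 'rV[R]_n)
    (gamma := (80 * L * l)^-1) (lambda := clip_level L C rho)
    (s := 2 * l / rho ^+ 2) :
  0 < L -> 2 <= l -> 0 < rho -> 0 < C -> C ^+ 2 = 2 ->
  convex_function [set: convex_lmodType 'rV[R]_n] f -> smooth L f ->
  minimizer f xs -> stochastic_gradient D f sigma G -> (0 < m)%N ->
  (forall i, (i < m)%N -> forall A, measurable A -> distribution P (z i) A = D A) ->
  (forall i j, (i < m)%N -> (j < m)%N -> i != j ->
    forall A B, measurable A -> measurable B ->
    P (z i @^-1` A `&` z j @^-1` B) = P (z i @^-1` A) * P (z j @^-1` B))%E ->
  (20 * L ^+ 2 * rho ^+ 2)^-1 * (sigma ^+ 2 / m%:R) <= c ->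
  norm2 (x - xs) ^+ 2 <= 2 * rho ^+ 2 ->
  (\int[P]_w (expR (s * (norm2 (x - xs -
       gamma *: clip (minibatch G m x (fun i => z i w)) lambda) ^+ 2
     - norm2 (x - xs) ^+ 2 + gamma * (f x - f xs))))%:E <= (expR c)%:E)%E.
Proof.
move=> L0 l2 rho0 C0 C2 cf sf mf sG m0 zD zI Vc xr.
have [dm [V hV Vle]] := minibatch_moments x (x - xs) sG m0 zD zI.
set A := (_ ^-1 : R) in Vc.
have A0 : 0 <= A by rewrite invr_ge0 !mulr_ge0 // ?exprn_ge0 // ltW.
have := has_meanD (has_meanD (has_mean_cst P 1) (has_meanZ (- (2 * s * gamma)) dm))
   (has_meanZ A hV).
set Y := (fun w => _ + A * _) => -[iY EY].
apply: (@le_trans _ _ (\int[P]_w (Y w)%:E)%E).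
  have mm : measurable_fun setT
     ((fun w => minibatch G m x (fun i => z i w)) : Omega -> borel_rV R n).
    by apply: measurable_minibatch => //; case: sG.
  have mY : measurable_fun setT (EFin \o Y) by exact: measurable_int iY.
  have YE w : expR (s * (norm2 (x - xs -
       gamma *: clip (minibatch G m x (fun i => z i w)) lambda) ^+ 2
     - norm2 (x - xs) ^+ 2 + gamma * (f x - f xs))) <= Y w.
    rewrite /Y mulNr; apply: expR_clipped_step_le => //.
    - by rewrite -(ler_pXn2r (n := 2)) ?nnegrE ?norm2_ge0
        ?(mulr_ge0 (ltW C0) (ltW rho0)) // exprMn C2.
    - exact: norm2_grad_le.
    - by apply: convex_grad_le => //; case: sf.
    - exact: sqr_norm2_grad_le.
  apply: ge0_le_integral => //.
  - apply/measurable_EFinP; apply: measurableT_comp => //.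
    apply: measurable_funM => //; apply: measurable_funD => //.
    apply: measurable_funB => //; apply: measurable_funX; apply: measurable_norm2.
    apply: measurable_rVB; first exact: (@measurable_cst _ _ Omega (borel_rV R n)).
    by apply: measurable_rVZ => //; exact: measurable_clip.
  - by move=> w ?; rewrite lee_fin YE.
rewrite EY lee_fin mulr0 addr0; apply: le_trans (expR_ge1Dx c).
by rewrite lerD2l; apply: le_trans Vc; rewrite ler_wpM2l.
Qed.

(** By induction, each step multiplies the expectation by at most [expR c]: batch [k] is integrated
    with the earlier samples frozen, and these alone determine the iterate and the potential at
    [k]. *)
Lemma expectation_potential_le (R : realType) (n : nat) (f : 'rV[R]_n -> R)
    (L sigma l C c : R) (d d' : measure_display) (Z : measurableType d)
    (D : probability Z R) (Omega : measurableType d') (P : probability Omega R)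
    (G : 'rV[R]_n -> Z -> 'rV[R]_n) (x0 xs : 'rV[R]_n) (N : nat) (m : nat -> nat)
    (xi : nat -> nat -> {RV P >-> Z}) (rho := norm2 (x0 - xs))
    (gamma := (80 * L * l)^-1) (lambda := clip_level L C rho)
    (s := 2 * l / rho ^+ 2) :
  0 < L -> 2 <= l -> 0 < rho -> 0 < C -> C ^+ 2 = 2 -> 0 <= c ->
  convex_function [set: convex_lmodType 'rV[R]_n] f -> smooth L f ->
  minimizer f xs -> stochastic_gradient D f sigma G ->
  (forall k, (k < N)%N -> (0 < m k)%N) -> iid_samples D N m xi ->
  (forall k, (k < N)%N ->
     (20 * L ^+ 2 * rho ^+ 2)^-1 * (sigma ^+ 2 / (m k)%:R) <= c) ->
  forall k, (k <= N)%N ->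
  (\int[P]_w (expR (s * potential f xs (2 * rho ^+ 2) G x0 m gamma lambda
      (fun k i => xi k i w) k))%:E <= (expR (s * rho ^+ 2 + k%:R * c))%:E)%E.
Proof.
move=> L0 l2 rho0 C0 C2 c0 cf sf mf sG m0 iid Vc.
have ctf : continuous f by move=> x; apply: differentiable_continuous; case: sf.
have mG : forall i, measurable_fun setT (fun p : borel_rV R n * Z => G p.1 p.2 0 i).
  by case: sG.
have gam0 : 0 <= gamma by rewrite invr_ge0 !mulr_ge0 ?(ltW L0) //; lra.
elim=> [_|k IH kN].
  by rewrite /= mul0r addr0; have [_ ->] := has_mean_cst P (expR (s * rho ^+ 2)).
have {}IH := IH (ltnW kN).
pose X (ki : nat * nat) : {RV P >-> Z} := xi ki.1 ki.2.
pose S1 : set (nat * nat) := [set ki | (ki.1 < k)%N && (ki.2 < m ki.1)%N].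
pose S2 : set (nat * nat) := [set ki | (ki.1 == k)%N && (ki.2 < m ki.1)%N].
pose O1 := g_sigma_algebraType (cylinders measurable X S1).
pose O2 := g_sigma_algebraType (cylinders measurable X S2).
pose xk w := clipped_sgd G x0 m gamma lambda (fun k i => xi k i w) k.
pose Wk w := potential f xs (2 * rho ^+ 2) G x0 m gamma lambda (fun k i => xi k i w) k.
(* On the diagonal this is the exponential of the potential at [k.+1]. Earlier samples enter only
   through [p.1], the batch of iteration [k] only through [p.2]. *)
pose h (p : O1 * O2) : \bar R := (expR (s * (if 2 * rho ^+ 2 < Wk p.1 then Wk p.1 else
  Wk p.1 + (norm2 (xk p.1 - xs - gamma *: clip (minibatch G (m k) (xk p.1)
    (fun i => xi k i p.2)) lambda) ^+ 2 - norm2 (xk p.1 - xs) ^+ 2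
    + gamma * (f (xk p.1) - f xs)))))%:E.
have mxi1 j i : (j < k)%N -> (i < m j)%N -> measurable_fun setT (xi j i : O1 -> Z).
  move=> jk im; apply: (@measurable_fun_cylinders _ _ _ _ X S1 (j, i)).
  by rewrite /S1 /= jk im.
have mxi2 i : (i < m k)%N -> measurable_fun setT (xi k i : O2 -> Z).
  move=> im; apply: (@measurable_fun_cylinders _ _ _ _ X S2 (k, i)).
  by rewrite /S2 /= eqxx im.
have mWk : measurable_fun setT (Wk : O1 -> R).
  by apply: measurable_potential.
have mxk : measurable_fun setT (xk : O1 -> borel_rV R n).
  by apply: measurable_clipped_sgd.
have mWk1 : measurable_fun setT (fun p : O1 * O2 => Wk p.1).
  by apply: (measurableT_comp mWk); exact: measurable_fst.
have mxk1 : measurable_fun setT ((fun p : O1 * O2 => xk p.1) : _ -> borel_rV R n).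
  by apply: (measurableT_comp mxk); exact: measurable_fst.
have mxks : measurable_fun setT ((fun p : O1 * O2 => xk p.1 - xs) : _ -> borel_rV R n).
  by apply: measurable_rVB => //; exact: (@measurable_cst _ _ _ (borel_rV R n)).
have mh : measurable_fun setT h.
  apply/measurable_EFinP; apply: measurableT_comp => //.
  apply: measurable_funM => //; apply: measurable_fun_ifT => //.
    exact: measurable_fun_ltr.
  apply: measurable_funD => //; apply: measurable_funD.
    apply: measurable_funB; apply: measurable_funX; apply: measurable_norm2 => //.
    apply: measurable_rVB => //; apply: measurable_rVZ => //; apply: measurable_clip.
    apply: measurable_minibatch => // i im.
    by apply: (measurableT_comp (mxi2 _ im)); exact: measurable_snd.
  apply: measurable_funM => //; apply: measurable_funB => //.
  apply: (measurableT_comp (f := f : borel_rV R n -> R)) => //.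
  exact: continuous_measurable_rV.
have mW : measurable_fun setT (Wk : Omega -> R).
  by apply: measurable_potential => // j i _ _; exact: measurable_funPT.
have mg : measurable_fun setT (fun w : Omega => ((expR c)%:E * (expR (s * Wk w))%:E)%E).
  apply/measurable_EFinP; apply: measurable_funM => //; apply: measurableT_comp => //.
  exact: measurable_funM.
have [_ mi] := iid.
have S1S : S1 `<=` [set ki | (ki.1 < N)%N && (ki.2 < m ki.1)%N].
  by move=> ki /andP[k1 h2]; rewrite /= h2 (ltn_trans k1 kN).
have S2S : S2 `<=` [set ki | (ki.1 < N)%N && (ki.2 < m ki.1)%N].
  by move=> ki /andP[/eqP k1 h2]; rewrite /= h2 k1 kN.
have S12 : S1 `&` S2 = set0.
  apply/seteqP; split=> // ki [/andP[k1 _] /andP[/eqP k2 _]].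
  by move: k1; rewrite k2 ltnn.
have h0 p : (0 <= h p)%E by rewrite lee_fin expR_ge0.
have hg w : (\int[P]_w' h (w, w') <= (expR c)%:E * (expR (s * Wk w))%:E)%E.
  rewrite /h /=; case: ltP => [_|Wb].
    have [_ ->] := has_mean_cst P (expR (s * Wk w)); rewrite -EFinM lee_fin.
    by rewrite ler_peMl ?expR_ge0 // -expR0 ler_expR.
  (* The sum in the potential is nonnegative because [xs] is a minimizer, so an unfrozen potential
     controls the distance. *)
  have Wx : norm2 (xk w - xs) ^+ 2 <= 2 * rho ^+ 2.
    have WE := potentialE Wb; rewrite /Wk WE in Wb; apply: le_trans Wb.
    rewrite -[leLHS]addr0; apply: lerD => //; rewrite mulr_ge0 //.
    by apply: sumr_ge0 => j _; rewrite subr_ge0; exact: mf.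
  have step := @expectation_clipped_step_le _ _ f L sigma l rho C c _ _ _ D _ P G
    (m k) (xi k) (xk w) xs L0 l2 rho0 C0 C2 cf sf mf sG (m0 k kN)
    (fun i im => iid.1 k i kN im)
    (fun i j im jm ij => iid_samples_pairwise iid kN im jm ij) (Vc k kN) Wx.
  under eq_integral do rewrite mulrDr expRD EFinM.
  rewrite ge0_integralZl //.
    by rewrite muleC; apply: lee_wpmul2r => //; rewrite lee_fin expR_ge0.
  apply/measurable_EFinP; apply: measurableT_comp => //; apply: measurable_funM => //.
  apply: measurable_funD => //; apply: measurable_funB => //; apply: measurable_funX.
  apply: measurable_norm2; apply: measurable_rVB.
    exact: (@measurable_cst _ _ Omega (borel_rV R n)).
  apply: measurable_rVZ => //; apply: measurable_clip.
  by apply: measurable_minibatch => // i im; exact: measurable_funPT.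
have := integral_freeze_le mi S1S S2S S12 mh h0 mg hg.
move=> /le_trans; apply.
rewrite ge0_integralZl //; last first.
  apply/measurable_EFinP; apply: measurableT_comp => //; exact: measurable_funM.
apply: (@le_trans _ _ ((expR c)%:E * (expR (s * rho ^+ 2 + k%:R * c))%:E)%E).
  by apply: lee_wpmul2l => //; rewrite lee_fin expR_ge0.
rewrite -EFinM -expRD lee_fin ler_expR -natr1; lra.
Qed.

(** * Tail bound and choice of parameters *)

Lemma ceil_nat_ge (R : realType) (x : R) : 0 <= x -> x <= (ceil_nat x)%:R.
Proof.
move=> x0; apply: le_trans (ceil_ge x) _.
by rewrite /ceil_nat natr_absz ger0_norm // -(ceil0 R) le_ceil.
Qed.

Lemma ceil_nat_lt (R : realType) (x : R) : 0 <= x -> (ceil_nat x)%:R < x + 1.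
Proof.
move=> x0; rewrite /ceil_nat natr_absz ger0_norm; last by rewrite -(ceil0 R) le_ceil.
by rewrite -ltrBlDr; have := ceilB1_lt x; rewrite intrB.
Qed.

Lemma batchsize_gt0 (R : realType) (L sigma C R0 beta : R) (N : nat) :
  (0 < batchsize L sigma C R0 beta N)%N.
Proof.
rewrite -(ltr_nat R); apply: (@lt_le_trans _ _ 1) => //.
by apply: le_trans _ (ceil_nat_ge _); rewrite le_max ?ler01 ?lexx.
Qed.

(** With [C ^+ 2 = 2] the batchsize [M] satisfies [sigma ^+ 2 / M <= 4 * L ^+ 2 * rho ^+ 2 * l / (27
    * N)], so the left side is even at most [l / (135 * N)]. *)
Lemma variance_batchsize_le (R : realType) (L sigma C rho beta : R) (N : nat)
    (l := ln (4 * N%:R / beta)) :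
  0 < L -> C ^+ 2 = 2 -> 0 < rho -> (1 <= N)%N -> 2 <= l ->
  (20 * L ^+ 2 * rho ^+ 2)^-1 *
    (sigma ^+ 2 / (batchsize L sigma C rho beta N)%:R) <= l / N%:R.
Proof.
move=> L0 C2 rho0 N1 l2.
have N0 : 0 < N%:R :> R by rewrite ltr0n.
have l0 : 0 < l by lra.
set M := batchsize _ _ _ _ _ _.
have M0 : 0 < M%:R :> R by rewrite ltr0n batchsize_gt0.
have MB : 27 * N%:R * sigma ^+ 2 / (2 * (C * rho) ^+ 2 * L ^+ 2 * l) <= M%:R.
  by apply: le_trans _ (ceil_nat_ge _); rewrite le_max ?ler01 // lexx orbT.
rewrite exprMn C2 ler_pdivrMr ?mulr_gt0 ?exprn_gt0 // in MB.
rewrite mulrA ler_pdivrMr // ler_pdivrMl ?mulr_gt0 ?exprn_gt0 //.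
rewrite (_ : _ * (l / N%:R * M%:R) = 20 * (L ^+ 2 * rho ^+ 2) * (l * M%:R) / N%:R).
  rewrite ler_pdivlMr //.
  have p : 0 <= L ^+ 2 * rho ^+ 2 * (l * M%:R).
    by rewrite !mulr_ge0 ?exprn_ge0 ?(ltW L0) ?(ltW rho0) ?(ltW l0) ?(ltW M0).
  by have h := mulr_ge0 (ltW N0) (sqr_ge0 sigma); lra.
by field; rewrite gt_eqF.
Qed.

(** The threshold [t] is left free so that it can be either the explicit rate or a target
    accuracy. *)
Lemma clipped_sgd_high_probability (R : realType) (n : nat) (f : 'rV[R]_n -> R)
    (L sigma : R) (d d' : measure_display) (Z : measurableType d)
    (D : probability Z R) (Omega : measurableType d') (P : probability Omega R)
    (G : 'rV[R]_n -> Z -> 'rV[R]_n) (x0 xs : 'rV[R]_n) (beta t : R) (N : nat)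
    (xi : nat -> nat -> {RV P >-> Z})
    (rho := norm2 (x0 - xs)) (C := Num.sqrt 2 : R) (l := ln (4 * N%:R / beta))
    (m := fun _ : nat => batchsize L sigma C rho beta N) :
  0 < L -> convex_function [set: convex_lmodType 'rV[R]_n] f -> smooth L f ->
  stochastic_gradient D f sigma G -> minimizer f xs -> 0 < rho ->
  0 < beta < 1 -> (1 <= N)%N -> 2 <= l -> iid_samples D N m xi ->
  80 * L * C ^+ 2 * rho ^+ 2 * l / N%:R <= t ->
  ((1 - beta)%:E <= P [set w | (f (clipped_sgd_output G x0 N m (stepsize L beta N)
     (clip_level L C rho) (fun k i => xi k i w)) - f xs <= t)%R])%E.
Proof.
move=> L0 cf sf sG mf rho0 /andP[b0 b1] N1 l2 iid ht.
have N0 : 0 < N%:R :> R by rewrite ltr0n.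
have l0 : 0 < l by lra.
have C2 : C ^+ 2 = 2 by rewrite sqr_sqrtr.
have C0 : 0 < C by rewrite sqrtr_gt0.
have ctf : continuous f by move=> x; apply: differentiable_continuous; case: sf.
have mG : forall i, measurable_fun setT (fun p : borel_rV R n * Z => G p.1 p.2 0 i).
  by case: sG.
set gamma := stepsize L beta N; set lambda := clip_level L C rho.
set s := 2 * l / rho ^+ 2.
have gam0 : 0 < gamma by rewrite invr_gt0 !mulr_gt0.
have sr : s * rho ^+ 2 = 2 * l by rewrite /s divfK // expf_neq0 // gt_eqF.
have s0 : 0 < s by rewrite !mulr_gt0 // invr_gt0 exprn_gt0.
pose V w := potential f xs (2 * rho ^+ 2) G x0 m gamma lambda (fun k i => xi k i w) N.
have mV : measurable_fun setT V.
  by apply: measurable_potential => // j i _ _; exact: measurable_funPT.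
(* The exponent starts at [s * rho ^+ 2 = 2 * l], and [N] steps add [N * (l / N) = l]. *)
have EV : (\int[P]_w (expR (s * V w))%:E <= (expR (3 * l))%:E)%E.
  have h := @expectation_potential_le _ n f L sigma l C (l / N%:R) _ _ Z D Omega P G
    x0 xs N m xi L0 l2 rho0 C0 C2 (divr_ge0 (ltW l0) (ltW N0)) cf sf mf sG
    (fun k _ => batchsize_gt0 _ _ _ _ _ _) iid
    (fun k _ => variance_batchsize_le sigma L0 C2 rho0 N1 l2) N (leqnn N).
  apply: le_trans h _; rewrite lee_fin ler_expR sr mulrCA divff ?gt_eqF //; lra.
pose bad := [set w | 2 * rho ^+ 2 < V w].
have mbad : measurable bad.
  rewrite -[X in measurable X]setTI.
  by apply: (measurable_fun_ltr (f := cst (2 * rho ^+ 2)) (g := V)).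
(* Markov's inequality: on [bad] the exponent exceeds [s * (2 * rho ^+ 2) = 4 * l], so the
   probability is at most [expR (- l) = beta / (4 * N)]. *)
have Pbad : (P bad <= beta%:E)%E.
  have mE : measurable_fun setT (fun w => (expR (s * V w))%:E).
    apply/measurable_EFinP; apply: measurableT_comp => //; exact: measurable_funM.
  have e4 : 0 < expR (4 * l) := expR_gt0 _.
  have := @le_integral_comp_abse _ _ _ P setT measurableT _ _ id
    (@measurable_id _ _ setT) (fun r r0 => r0) (fun x y _ _ xy => xy) mE e4.
  rewrite setTI; set big := [set _ | _].
  have -> : (\int[P]_w `|(expR (s * V w))%:E| = \int[P]_w (expR (s * V w))%:E)%E.
    by apply: eq_integral => w _; rewrite gee0_abs // lee_fin expR_ge0.
  move=> /le_trans /(_ EV) h.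
  have mbig : measurable big.
    rewrite -[X in measurable X]setTI; apply: emeasurable_fun_c_infty => //.
    exact: measurableT_comp.
  have bb : bad `<=` big.
    move=> w; rewrite /bad /big /= ger0_norm ?expR_ge0 // lee_fin ler_expR => Vw.
    by rewrite (_ : 4 * l = s * (2 * rho ^+ 2)) ?ler_pM2l ?ltW //; lra.
  apply: (@le_trans _ _ (P big)); first by rewrite le_measure ?inE.
  have pb : P big \is a fin_num by exact: fin_num_measure.
  have {}h : ((expR (4 * l))%:E * P big <= (expR (3 * l))%:E)%E := h.
  rewrite -(fineK pb) lee_fin; rewrite -(fineK pb) -EFinM lee_fin in h.
  rewrite -ler_pdivlMl // -expRN -expRD in h.
  apply: le_trans h _; rewrite (_ : - (4 * l) + 3 * l = - l); last by ring.
  have N1R : 1 <= N%:R :> R by rewrite ler1n.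
  have fourN : 1 <= 4 * N%:R :> R by lra.
  rewrite expRN lnK ?posrE ?divr_gt0 ?mulr_gt0 // invf_div.
  by rewrite ler_pdivrMr ?mulr_gt0 // ler_peMr // ltW.
set good := [set w | _].
have mgood : measurable good.
  rewrite -[X in measurable X]setTI.
  apply: (measurable_fun_ler (g := cst t)) => //; apply: measurable_funB => //.
  apply: (measurableT_comp (f := f : borel_rV R n -> R)).
    exact: continuous_measurable_rV.
  apply: measurable_rVZ => //; apply: measurable_rV_sum => k.
  by apply: measurable_clipped_sgd => // j i _ _; exact: measurable_funPT.
(* Dropping the squared distance leaves [gamma] times the sum of the gaps at most [2 * rho ^+ 2].
   Jensen's inequality and division by [gamma * N] give the rate, as
   [2 / gamma = 80 * L * C ^+ 2 * l]. *)
have badC : ~` bad `<=` good.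
  move=> w /negP; rewrite -leNgt /= => Vw.
  have E := potentialE Vw; rewrite /V E in Vw.
  set x := clipped_sgd _ _ _ _ _ _ in E Vw.
  have {}Vw : gamma * \sum_(j < N) (f (x j) - f xs) <= 2 * rho ^+ 2.
    by apply: le_trans Vw; rewrite -[leLHS]add0r lerD2r sqr_ge0.
  apply: le_trans ht; rewrite C2.
  have J := convex_mean_le x cf N1.
  apply: (@le_trans _ _ (N%:R^-1 * \sum_(j < N) (f (x j) - f xs))).
    rewrite sumrB sumr_const card_ord mulrBr -[f xs *+ N]mulr_natl.
    by rewrite mulKf ?gt_eqF // lerD2r.
  rewrite ler_pdivrMl // (_ : N%:R * _ = 2 * rho ^+ 2 / gamma).
    by rewrite ler_pdivlMr // mulrC.
  by rewrite /gamma /stepsize invrK mulrCA mulfV ?gt_eqF // -/l; ring.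
apply: (@le_trans _ _ (P (~` bad))); last first.
  by rewrite le_measure ?inE //; exact: measurableC.
by rewrite probability_setC // EFinB leeB.
Qed.

(** The quadratic bound on the exponential equals 2 at [1 / 2]. *)
Lemma ln2_ge_half (R : realType) : 2^-1 <= ln (2 : R).
Proof.
rewrite -[leLHS]expRK ler_ln ?posrE ?expR_gt0 //.
by apply: le_trans (expR_le_quadratic (lexx _)) _; lra.
Qed.

Lemma iteration_count_bounds (R : realType) (A beta : R) (K := 2 ^+ 12 : R)
    (q := A / beta) (N := ceil_nat (K * A * ln q)) (l := ln (4 * N%:R / beta)) :
  2 <= A -> 0 < beta < 1 ->
  [/\ (1 <= N)%N /\ 0 < ln q, 2 <= l, 160 * A * l <= N%:R, ln q <= l
    & N%:R <= 2 * (K * A * ln q)].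
Proof.
move=> A2 /andP[b0 b1].
have A0 : 0 < A by lra.
have Aq : A <= q by rewrite ler_pdivlMr // ler_piMr ?ltW.
have q2 : 2 <= q by exact: le_trans Aq.
have q0 : 0 < q by lra.
have lnq : 2^-1 <= ln q.
  by apply: le_trans (ln2_ge_half R) _; rewrite ler_ln ?posrE.
have KE : 160 * 17 <= K.
  have -> : K = 2 ^+ 6 * 2 ^+ 6 by rewrite -exprD.
  have -> : 2 ^+ 6 = 64 :> R by rewrite -natrX.
  lra.
have K0 : 0 < K by rewrite exprn_gt0.
have K8 : 2 ^+ 15 = 8 * K by rewrite (exprD 2 3 12) -natrX.
clearbody K.
have AX : 1 <= A * ln q.
  by rewrite -[leLHS](@mulfV _ 2) //; apply: ler_pM => //; rewrite invr_ge0.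
have XK : K <= K * A * ln q by rewrite -mulrA ler_peMr // ltW.
have X0 : 0 <= K * A * ln q by apply: le_trans XK; exact: ltW.
have NX : K * A * ln q <= N%:R by exact: ceil_nat_ge.
(* Rounding up adds less than 1, and [K * A * ln q] is at least [K]. *)
have N2X : N%:R <= 2 * (K * A * ln q).
  by have := ceil_nat_lt X0; rewrite -/N; lra.
have N16 : 16 <= N%:R :> R by apply: le_trans NX; apply: le_trans XK; lra.
have N0 : 0 < N%:R :> R by lra.
have NB : N%:R <= 4 * N%:R / beta.
  rewrite ler_pdivlMr //; apply: le_trans (_ : N%:R * 1 <= _).
    by rewrite ler_pM2l // ltW.
  by lra.
(* [expR 2] is the fourth power of [expR (1 / 2) <= 2], hence at most 16. *)
have l2 : 2 <= l.
  rewrite -[leLHS]expRK ler_ln ?posrE ?expR_gt0 ?divr_gt0 ?mulr_gt0 //.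
  apply: le_trans NB; apply: le_trans N16.
  have -> : (2 : R) = 4%:R * 2^-1 by lra.
  rewrite expRM_natl; apply: (@le_trans _ _ (2 ^+ 4)); last by lra.
  rewrite ler_pXn2r ?nnegrE ?expR_ge0 //.
  by apply: le_trans (expR_le_quadratic (lexx _)) _; lra.
have lqq : ln q <= q.
  by rewrite -ler_expR lnK ?posrE //; have := expR_ge1Dx q; lra.
(* By [N2X], [4 * N / beta <= 8 * K * q * ln q = 2 ^+ 15 * (q * ln q)]. With [2 <= q] and
   [ln q <= q] this is at most [q ^+ 17]. *)
have l17 : l <= 17%:R * ln q.
  rewrite mulr_natl -lnXn // ler_ln ?posrE ?exprn_gt0 ?divr_gt0 ?mulr_gt0 //.
  apply: (@le_trans _ _ (2 ^+ 15 * (q * ln q))).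
    rewrite ler_pdivrMr // (_ : 2 ^+ 15 * _ * beta = 8 * (K * A * ln q)).
      by lra.
    by rewrite K8 /q; field; rewrite gt_eqF.
  rewrite (exprD q 15 2) expr2; apply: ler_pM.
  - by rewrite exprn_ge0.
  - by rewrite mulr_ge0 ?(ltW q0) //; lra.
  - by rewrite ler_pXn2r ?nnegrE // ltW.
  - by rewrite ler_pM2l.
split=> //.
- by split; [rewrite -(ltr_nat R)|lra].
- apply: le_trans NX; rewrite -mulrA [K * A]mulrC -mulrA mulrCA.
  have lnq0 : 0 <= ln q by lra.
  by rewrite ler_pM2l //; have := ler_wpM2r lnq0 KE; lra.
- rewrite ler_ln ?posrE ?divr_gt0 ?mulr_gt0 // ler_pM2r ?invr_gt0 //.
  apply: (@le_trans _ _ (K * A * ln q)); last lra.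
  rewrite mulrAC ler_peMl ?(ltW A0) //.
  by apply: (@le_trans _ _ (K * 2^-1)); [lra|rewrite ler_pM2l].
Qed.

(** The batchsize is at most [2 + B]. The part [2 * N] gives the constant [4 * K], the part [N * B]
    the constant [27 * K ^+ 2]. *)
Lemma oracle_calls_le (R : realType) (L sigma rho eps beta : R) (K := 2 ^+ 12 : R)
    (C := Num.sqrt 2 : R) (A := L * rho ^+ 2 / eps) (q := A / beta)
    (N := ceil_nat (K * A * ln q)) :
  0 < L -> 0 < rho -> 0 < eps -> 2 <= A -> 0 < beta < 1 ->
  (oracle_calls N (fun=> batchsize L sigma C rho beta N))%:R <=
  (4 * K + 27 * K ^+ 2) * Num.max A (sigma ^+ 2 * rho ^+ 2 / eps ^+ 2) * ln q.
Proof.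
move=> L0 rho0 eps0 A2 b01.
have [[N1 q0] l2 _ ql N2X] := iteration_count_bounds A2 b01.
rewrite -/N in N1 l2 ql N2X; set l := ln (4 * N%:R / beta) in l2 ql.
have l0 : 0 < l by lra.
have C2 : C ^+ 2 = 2 by rewrite sqr_sqrtr.
have N0 : 0 < N%:R :> R by rewrite ltr0n.
rewrite /oracle_calls sum_nat_const card_ord natrM.
set B := 27 * N%:R * sigma ^+ 2 / (2 * (C * rho) ^+ 2 * L ^+ 2 * l).
have B0 : 0 <= B.
  apply: divr_ge0; first by rewrite mulr_ge0 ?sqr_ge0 // mulr_ge0.
  by rewrite ltW // exprMn C2 !mulr_gt0 ?exprn_gt0.
have MB : (batchsize L sigma C rho beta N)%:R <= 2 + B.
  have M1 : 1 <= Num.max 1 B by rewrite le_max lexx.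
  have := ceil_nat_lt (le_trans ler01 M1); rewrite -/(batchsize _ _ _ _ _ _).
  have : Num.max 1 B <= 1 + B by rewrite ge_max; apply/andP; split; lra.
  rewrite /batchsize -/l -/B; lra.
set T := Num.max _ _.
have AT : A <= T by rewrite le_max lexx.
have ST : sigma ^+ 2 * rho ^+ 2 / eps ^+ 2 <= T by rewrite le_max lexx orbT.
have K0 : 0 < K by rewrite exprn_gt0.
have A0 : 0 < A by lra.
set X := K * A * ln q in N2X.
have X0 : 0 <= X by exact: (mulr_ge0 (mulr_ge0 (ltW K0) (ltW A0)) (ltW q0)).
apply: le_trans (_ : N%:R * (2 + B) <= _); first by rewrite ler_pM2l.
rewrite mulrDr [X in _ <= X](_ : _ = 4 * K * T * ln q + 27 * K ^+ 2 * T * ln q); last ring.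
apply: lerD.
  apply: (@le_trans _ _ (4 * X)); first lra.
  rewrite /X (_ : 4 * _ = 4 * K * A * ln q); last ring.
  by rewrite ler_pM2r // ler_pM2l // mulr_gt0.
rewrite /B exprMn C2.
(* [N ^+ 2] brings two factors [ln q]; since [ln q <= l], the [l] in the denominator cancels one of
   them. *)
apply: (@le_trans _ _ (27 * (2 * X) ^+ 2 * sigma ^+ 2 / (4 * rho ^+ 2 * L ^+ 2 * ln q))).
  rewrite mulrA (_ : N%:R * _ = 27 * N%:R ^+ 2 * sigma ^+ 2); last ring.
  apply: ler_pM.
  - by rewrite mulr_ge0 ?sqr_ge0 // mulr_ge0 ?sqr_ge0.
  - by rewrite invr_ge0 ltW // !mulr_gt0 ?exprn_gt0.
  - apply: ler_wpM2r; first exact: sqr_ge0.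
    rewrite ler_pM2l //; apply: lerXn2r => //; rewrite nnegrE ?(ltW N0) //.
    by apply: mulr_ge0.
  - rewrite lef_pV2 ?posrE ?mulr_gt0 ?exprn_gt0 //.
    rewrite (_ : 2 * _ * _ * l = 4 * rho ^+ 2 * L ^+ 2 * l); last ring.
    by rewrite ler_pM2l // !mulr_gt0 ?exprn_gt0.
rewrite (_ : _ / _ = 27 * K ^+ 2 * (sigma ^+ 2 * rho ^+ 2 / eps ^+ 2) * ln q); last first.
  by rewrite /X /A; field; rewrite !gt_eqF.
by rewrite ler_pM2r // ler_pM2l // mulr_gt0 ?exprn_gt0.
Qed.

Theorem theoremG1 (R : realType) :
  exists K K' : R, 0 < K /\ 0 < K' /\
  forall (n : nat) (f : 'rV[R]_n -> R) (L sigma : R)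
    (d : measure_display) (Z : measurableType d) (D : probability Z R)
    (G : 'rV[R]_n -> Z -> 'rV[R]_n) (x0 xs : 'rV[R]_n),
  0 < L -> 0 <= sigma ->
  convex_function [set: convex_lmodType 'rV[R]_n] f ->
  smooth L f ->
  stochastic_gradient D f sigma G ->
  minimizer f xs ->
  let R0 := norm2 (x0 - xs) in
  let C := Num.sqrt 2 : R in
  0 < R0 ->
  (forall (beta : R) (N : nat),
    0 < beta < 1 -> (1 <= N)%N -> 2 <= ln (4 * N%:R / beta) ->
    let m := fun _ : nat => batchsize L sigma C R0 beta N in
    forall (d' : measure_display) (Omega : measurableType d')
      (P : probability Omega R) (xi : nat -> nat -> {RV P >-> Z}),
    iid_samples D N m xi ->
    let xbar := fun w => clipped_sgd_output G x0 N m
      (stepsize L beta N) (clip_level L C R0) (fun k i => xi k i w) in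
    ((1 - beta)%:E <=
       P [set w | (f (xbar w) - f xs <=
            80 * L * C ^+ 2 * R0 ^+ 2 * ln (4 * N%:R / beta) / N%:R)%R])%E)
  /\
  (forall eps beta : R,
    0 < eps <= L * R0 ^+ 2 / 2 -> 0 < beta < 1 ->
    let N := ceil_nat (K * (L * R0 ^+ 2 / eps) *
                       ln (L * R0 ^+ 2 / (eps * beta))) in
    let m := fun _ : nat => batchsize L sigma C R0 beta N in
    (forall (d' : measure_display) (Omega : measurableType d')
       (P : probability Omega R) (xi : nat -> nat -> {RV P >-> Z}),
     iid_samples D N m xi ->
     let xbar := fun w => clipped_sgd_output G x0 N m
       (stepsize L beta N) (clip_level L C R0) (fun k i => xi k i w) in
     ((1 - beta)%:E <= P [set w | (f (xbar w) - f xs <= eps)%R])%E)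
    /\
    (oracle_calls N m)%:R <=
      K' * Num.max (L * R0 ^+ 2 / eps) (sigma ^+ 2 * R0 ^+ 2 / eps ^+ 2) *
      ln (L * R0 ^+ 2 / (eps * beta))).
Proof.
pose K : R := 2 ^+ 12; have K0 : 0 < K by rewrite exprn_gt0.
exists K, (4 * K + 27 * K ^+ 2); split => //; split.
  by rewrite addr_gt0 ?mulr_gt0 ?exprn_gt0.
move=> n f L sigma d Z D G x0 xs L0 sigma0 cf sf sG mf R0 C R00; split.
  move=> beta N b01 N1 l2 m d' Omega P xi iid.
  exact: (clipped_sgd_high_probability (D := D)).
move=> eps beta /andP[eps0 epsL] b01.
have b0 : 0 < beta by case/andP: b01.
have A2 : 2 <= L * R0 ^+ 2 / eps.
  by rewrite ler_pdivlMr // mulrC -ler_pdivlMr.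
have -> : L * R0 ^+ 2 / (eps * beta) = L * R0 ^+ 2 / eps / beta.
  by rewrite invfM mulrA.
move=> N m; split; last exact: oracle_calls_le.
move=> d' Omega P xi iid.
have [[N1 _] l2 Nl _ _] := iteration_count_bounds A2 b01.
apply: (clipped_sgd_high_probability (D := D)) => //.
rewrite ler_pdivrMr ?ltr0n // sqr_sqrtr //.
(* Multiplied by [eps], the bound [160 * A * l <= N] says that the rate is at most [eps], because
   [80 * C ^+ 2 = 160]. *)
have := ler_wpM2l (ltW eps0) Nl; rewrite -/N; apply: le_trans.
rewrite (_ : eps * _ = 160 * (L * R0 ^+ 2 * ln (4 * N%:R / beta))).
  by rewrite -/R0; lra.
by rewrite /N; field; rewrite gt_eqF.
Qed.
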